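(* Let $G$ be a group, $\mathfrak{X}$ a family of subgroups of $G$, $0\le n\le\infty$, and let $A$ be an $\mathcal{O}_{\mathfrak{X}}G$-module. Then the following are equivalent: (i) $A$ is of type Bredon-$\mathrm{FP}_n$. (ii) For every exact limit (of covariant $\mathcal{O}_{\mathfrak{X}}G$-modules $N_*$), the natural homomorphism $$\operatorname{Tor}^{\mathfrak{X}}_k(\varprojlim N_*,A)\to\varprojlim\operatorname{Tor}^{\mathfrak{X}}_k(N_*,A)$$ is an isomorphism for all $k\le n-1$ and an epimorphism for $k=n$. (iii) For every choice of index sets $\Lambda_K$, $K\in\mathfrak{X}$, with corresponding direct products $\prod_{\Lambda_K}\mathbb{Z}[G/K,-]$, the natural map $$\operatorname{Tor}^{\mathfrak{X}}_k\Big(\prod_{K\in\mathfrak{X}}\prod_{\Lambda_K}\mathbb{Z}[G/K,-],A\Big)\to\prod_{K\in\mathfrak{X}}\prod_{\Lambda_K}\operatorname{Tor}^{\mathfrak{X}}_k(\mathbb{Z}[G/K,-],A)$$ is an isomorphism for all $k\le n-1$ and an epimorphism for $k=n$.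
   Context: $\mathfrak{X}$ is a family of subgroups of $G$ (closed under conjugation). The orbit category $\mathcal{O}_{\mathfrak{X}}G$ has as objects the transitive $G$-sets with stabilisers in $\mathfrak{X}$ and as morphisms the $G$-maps. An $\mathcal{O}_{\mathfrak{X}}G$-module is a contravariant functor from $\mathcal{O}_{\mathfrak{X}}G$ to abelian groups; a covariant $\mathcal{O}_{\mathfrak{X}}G$-module (comodule) is a covariant such functor. Exactness, limits and colimits are defined pointwise. For transitive $\Delta$, $\Gamma$, $\mathbb{Z}[\Gamma,\Delta]$ is the free abelian group on the set of $G$-maps $\Gamma\to\Delta$. The contravariant modules $\mathbb{Z}[-,G/K]$ (respectively the covariant modules $\mathbb{Z}[G/K,-]$), $K\in\mathfrak{X}$, are free, and direct sums of these are the free contravariant (respectively covariant) modules. For a $G$-set $\Delta$ with stabilisers in $\mathfrak{X}$, $\mathbb{Z}[-,\Delta]$ is the direct sum over the $G$-orbits of $\Delta$; a contravariant module is finitely generated if it is a quotient of $\mathbb{Z}[-,\Delta]$ for some $\Delta$ with finitely many orbits. For $L$ covariant and $M$ contravariant, $L\otimes_{\mathfrak{X}}M$ is the categorical tensor product: the quotient of $\bigoplus_\Delta L(\Delta)\otimes_{\mathbb{Z}} M(\Delta)$ by the relations $L(\varphi)(x)\otimes m=x\otimes M(\varphi)(m)$ for morphisms $\varphi$. $\operatorname{Tor}^{\mathfrak{X}}_*(L,M)=H_*(L\otimes_{\mathfrak{X}}P_* )$ for a projective resolution $P_*\to M$. A module $A$ is of type Bredon-$\mathrm{FP}_n$ if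 it has a projective resolution $P_*\to A$ with $P_i$ finitely generated for all $i\le n$ (for all $i$, if $n=\infty$). ''Exact limit'' means a limit $\varprojlim$ of a system of comodules $N_*$ over an index category for which the limit functor is exact (for example, direct products). *)

(* Defs.v *)
From HB Require Import structures.
From mathcomp Require Import all_boot all_order all_algebra generic_quotient.
From mathcomp Require Import ring_quotient.
From mathcomp Require Import boolp.
From mathcomp.multinomials Require Import freeg.

Set Implicit Arguments.
Unset Strict Implicit.
Unset Printing Implicit Defensive.

Import GRing.Theory.
Local Open Scope ring_scope.
Local Open Scope quotient_scope.

Definition additive_of (U V : zmodType) (f : U -> V)
    (fB : {morph f : x y / x - y}) : {additive U -> V} :=
  HB.pack f (GRing.isZmodMorphism.Build U V f fB).

Definition surjective (S T : Type) (f : S -> T) : Prop :=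
  forall y, exists x, f x = y.

Definition subgrp (V : zmodType) (S : zmodClosed V) : Type :=
  {x : V | x \in S}.

Section Subgrp.
Variables (V : zmodType) (S : zmodClosed V).
HB.instance Definition _ := SubChoice.on (subgrp S).
HB.instance Definition _ := [SubChoice_isSubZmodule of subgrp S by <:].
End Subgrp.

Inductive generated (V : zmodType) (R : V -> Prop) : V -> Prop :=
| gen_in x : R x -> generated R x
| gen_0 : generated R 0
| gen_sub x y : generated R x -> generated R y -> generated R (x - y).

Definition gspan (V : zmodType) (R : V -> Prop) : {pred V} :=
  fun x => `[< generated R x >].

Section GSpan.
Variables (V : zmodType) (R : V -> Prop).
Fact gspan_closed : zmod_closed (gspan R).
Proof.
split=> [|x y /asboolP Hx /asboolP Hy]; apply/asboolP; first exact: gen_0.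
exact: gen_sub.
Qed.
HB.instance Definition _ := GRing.isZmodClosed.Build V (gspan R) gspan_closed.
End GSpan.

Definition quotgrp (V : zmodType) (R : V -> Prop) : zmodType :=
  Quotient.quot (gspan R : zmodClosed V).

Definition quot_pi (V : zmodType) (R : V -> Prop) (x : V) : quotgrp R :=
  \pi_(Quotient.quot (gspan R : zmodClosed V)) x.

Section QuotTheory.
Variables (V : zmodType) (R : V -> Prop).

Fact quot_piB : {morph @quot_pi V R : x y / x - y}.
Proof. exact: (raddfB (\pi_(Quotient.quot (gspan R : zmodClosed V)))). Qed.

Fact quot_piP (x y : V) : quot_pi R x = quot_pi R y <-> generated R (x - y).
Proof.
rewrite -(asboolE (generated R _)) -[`[< _ >]]/(x - y \in gspan R).
rewrite Quotient.idealrBE; split=> [H|/eqP //]; exact/eqP.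
Qed.

Fact quot_surj (q : quotgrp R) : exists x, quot_pi R x = q.
Proof. by exists (repr q); rewrite /quot_pi reprK. Qed.
End QuotTheory.

Section QuotMap.
Variables (V V' : zmodType) (R : V -> Prop) (R' : V' -> Prop).
Variables (f : {additive V -> V'}).
Hypothesis fR : forall x, R x -> generated R' (f x).

Definition quot_map_fun (q : quotgrp R) : quotgrp R' := quot_pi R' (f (repr q)).

Fact quot_map_funE x : quot_map_fun (quot_pi R x) = quot_pi R' (f x).
Proof.
apply/quot_piP; rewrite -raddfB.
have : generated R (repr (quot_pi R x) - x).
  by apply/quot_piP; rewrite /quot_pi reprK.
elim=> [y /fR //||y z _ IHy _ IHz]; first by rewrite raddf0; apply: gen_0.
by rewrite raddfB; apply: gen_sub.
Qed.

Fact quot_map_funB : {morph quot_map_fun : x y / x - y}.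
Proof.
move=> p q; have [x <-] := quot_surj p; have [y <-] := quot_surj q.
by rewrite -quot_piB !quot_map_funE raddfB quot_piB.
Qed.

Definition quot_map : {additive quotgrp R -> quotgrp R'} :=
  additive_of quot_map_funB.
End QuotMap.

Definition dprod (I : Type) (V : I -> zmodType) : Type := forall i, V i.

Section Dprod.
Variables (I : Type) (V : I -> zmodType).
Implicit Types f g h : dprod V.
HB.instance Definition _ := gen_eqMixin (dprod V).
HB.instance Definition _ := gen_choiceMixin (dprod V).

Let zero : dprod V := fun=> 0.
Let opp f : dprod V := fun i => - f i.
Let add f g : dprod V := fun i => f i + g i.

Fact dprod_addA : associative add.
Proof.
by move=> f g h; apply: functional_extensionality_dep => i; apply: addrA.
Qed.
Fact dprod_addC : commutative add.
Proof.
by move=> f g; apply: functional_extensionality_dep => i; apply: addrC.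
Qed.
Fact dprod_add0 : left_id zero add.
Proof.
by move=> f; apply: functional_extensionality_dep => i; apply: add0r.
Qed.
Fact dprod_addN : left_inverse zero opp add.
Proof.
by move=> f; apply: functional_extensionality_dep => i; apply: addNr.
Qed.
HB.instance Definition _ :=
  GRing.isZmodule.Build (dprod V) dprod_addA dprod_addC dprod_add0 dprod_addN.
End Dprod.

Section DprodMaps.
Variables (I : Type) (V : I -> zmodType).

Definition dproj (i : I) : {additive dprod V -> V i} :=
  @additive_of (dprod V) (V i) (fun f => f i) (fun f g => erefl).

Variables (U : zmodType) (f : forall i, {additive U -> V i}).

Fact dtupleB : {morph (fun u => (fun i => f i u) : dprod V) : x y / x - y}.
Proof.
by move=> x y; apply: functional_extensionality_dep => i; apply: raddfB.
Qed.

Definition dtuple : {additive U -> dprod V} := additive_of dtupleB.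
End DprodMaps.
Arguments dproj {I V} i.

Definition freeg_map (S T : choiceType) (f : S -> T) :
    {additive {freeg S} -> {freeg T}} :=
  @additive_of {freeg S} {freeg T} (fglift (fun s => << f s >> : {freeg T}))
    (@lift_is_additive _ _ _ _).

Fact freeg_mapU (S T : choiceType) (f : S -> T) (s : S) :
  freeg_map f << s >> = << f s >>.
Proof. by rewrite /= liftU scale1r. Qed.

Fact freeg_ext (S : choiceType) (V : zmodType) (f g : {additive {freeg S} -> V}) :
  (forall s, f << s >> = g << s >>) -> f =1 g.
Proof.
move=> fg D; rewrite -(freeg_sumE D) !raddf_sum; apply: eq_bigr => s _.
rewrite -[coeff s D]intz -freegU_mulz !raddfMz fg //.
Qed.

Section FreegLift.
Variables (S : choiceType) (V : zmodType) (f : S -> V).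

Definition freeg_lift_fun (D : {freeg S}) : V :=
  \sum_(s <- dom D) f s *~ coeff s D.

Fact freeg_lift_funE (D : {freeg S}) :
  freeg_lift_fun D = fglift (f : S -> zmodule V) D.
Proof.
have -> : fglift (f : S -> zmodule V) D =
  additive_of (@lift_is_additive _ _ (zmodule V) f) D by [].
rewrite -{2}(freeg_sumE D) raddf_sum; apply: eq_bigr => s _ /=.
by rewrite liftU.
Qed.

Fact freeg_lift_funB : {morph freeg_lift_fun : x y / x - y}.
Proof.
move=> x y; rewrite !freeg_lift_funE.
exact: (@lift_is_additive _ _ (zmodule V)).
Qed.

Definition freeg_lift : {additive {freeg S} -> V} :=
  additive_of freeg_lift_funB.

Fact freeg_liftU s : freeg_lift << s >> = f s.
Proof. by rewrite [LHS]freeg_lift_funE liftU scale1r. Qed.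
End FreegLift.

Definition kernel (V W : zmodType) (g : {additive V -> W}) : {pred V} :=
  fun x => g x == 0.

Section Kernel.
Variables (V W : zmodType) (g : {additive V -> W}).
Fact kernel_closed : zmod_closed (kernel g).
Proof.
split=> [|x y]; first by rewrite unfold_in raddf0.
rewrite !unfold_in; move=> /eqP gx /eqP gy; by rewrite raddfB gx gy subrr.
Qed.
HB.instance Definition _ := GRing.isZmodClosed.Build V (kernel g) kernel_closed.
End Kernel.

(* ker g modulo ker g :&: im f, for U --f--> V --g--> W *)
Definition homology (U V W : zmodType)
    (f : {additive U -> V}) (g : {additive V -> W}) : zmodType :=
  quotgrp (fun z : subgrp (kernel g) => exists u, f u = val z).

Section HomologyMap.
Variables (U V W U' V' W' : zmodType).
Variables (f : {additive U -> V}) (g : {additive V -> W}).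
Variables (f' : {additive U' -> V'}) (g' : {additive V' -> W'}).
Variable b : {additive V -> V'}.
Hypothesis b_ker : forall v, g v = 0 -> g' (b v) = 0.
Hypothesis b_im : forall u, exists u', f' u' = b (f u).

Fact ker_map_subproof (z : subgrp (kernel g)) : b (val z) \in kernel g'.
Proof. by rewrite unfold_in; apply/eqP/b_ker/eqP/(valP z). Qed.

Definition ker_map_fun (z : subgrp (kernel g)) : subgrp (kernel g') :=
  Sub (b (val z)) (ker_map_subproof z).

Fact ker_map_funE z : val (ker_map_fun z) = b (val z).
Proof. exact: SubK. Qed.

Fact ker_map_funB : {morph ker_map_fun : x y / x - y}.
Proof. by move=> x y; apply: val_inj; rewrite raddfB /= !raddfB. Qed.

Fact homology_map_subproof (z : subgrp (kernel g)) :
  (exists u, f u = val z) ->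
  generated (fun z' => exists u', f' u' = val z') (additive_of ker_map_funB z).
Proof.
move=> [u fu]; apply: gen_in; have [u' fu'] := b_im u.
by exists u'; rewrite fu' fu.
Qed.

Definition homology_map : {additive homology f g -> homology f' g'} :=
  quot_map homology_map_subproof.

Fact homology_mapE z : homology_map (quot_pi _ z) = quot_pi _ (ker_map_fun z).
Proof. exact: (quot_map_funE homology_map_subproof z). Qed.
End HomologyMap.

Definition exact (U V W : zmodType)
    (f : {additive U -> V}) (g : {additive V -> W}) : Prop :=
  forall v, g v = 0 <-> exists u, f u = v.

Definition short_exact (U V W : zmodType)
    (f : {additive U -> V}) (g : {additive V -> W}) : Prop :=
  [/\ injective f, exact f g & surjective g].

Record category := Category {
  obj :> Type;
  mor : obj -> obj -> Type;
  idm : forall x, mor x x;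
  compose : forall x y z, mor y z -> mor x y -> mor x z;
  compose_idl : forall x y (f : mor x y), compose (idm y) f = f;
  compose_idr : forall x y (f : mor x y), compose f (idm x) = f;
  compose_assoc : forall x y z t (h : mor z t) (g : mor y z) (f : mor x y),
    compose h (compose g f) = compose (compose h g) f }.
Arguments idm {c} x.

Definition opcat (C : category) : category :=
  @Category C (fun x y => mor y x) (fun x => idm x) (fun x y z g f => compose f g)
    (fun x y f => compose_idr f) (fun x y f => compose_idl f)
    (fun x y z t h g f => esym (compose_assoc f g h)).

Record functor (C : category) := Functor {
  fobj :> C -> zmodType;
  fmap : forall x y, mor x y -> {additive fobj x -> fobj y};
  fmap_id : forall x (a : fobj x), fmap (idm x) a = a;
  fmap_comp : forall x y z (g : mor y z) (f : mor x y) (a : fobj x),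
    fmap (compose g f) a = fmap g (fmap f a) }.

Record nattrans (C : category) (F F' : functor C) := NatTrans {
  component :> forall x, {additive F x -> F' x};
  naturality : forall x y (f : mor x y) (a : F x),
    component y (fmap F f a) = fmap F' f (component x a) }.

Definition nt_id (C : category) (F : functor C) : nattrans F F :=
  @NatTrans C F F (fun x => idfun) (fun _ _ _ _ => erefl).

Definition nt_comp (C : category) (F1 F2 F3 : functor C)
    (b : nattrans F2 F3) (a : nattrans F1 F2) : nattrans F1 F3.
Proof.
exists (fun x => b x \o a x) => x y f u.
by rewrite /= !naturality.
Defined.

(* A functor from I to the category of functors from C to abelian groups *)
Record diagram (I C : category) := Diagram {
  dobj :> I -> functor C;
  dmap : forall i j, mor i j -> nattrans (dobj i) (dobj j);
  dmap_id : forall i x (a : dobj i x), dmap (idm i) x a = a;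
  dmap_comp : forall i j k (v : mor j k) (u : mor i j) x (a : dobj i x),
    dmap (compose v u) x a = dmap v x (dmap u x a) }.

Record diagram_map (I C : category) (D D' : diagram I C) := DiagramMap {
  dcomponent :> forall i, nattrans (D i) (D' i);
  dnaturality : forall i j (u : mor i j) x (a : D i x),
    dcomponent j x (dmap D u x a) = dmap D' u x (dcomponent i x a) }.

Definition compatible (I : category) (D : functor I) : {pred dprod D} :=
  fun a => `[< forall i j (u : mor i j), fmap D u (a i) = a j >].

Section Limit.
Variables (I : category) (D : functor I).
Fact compatible_closed : zmod_closed (@compatible I D).
Proof.
split=> [|a b /asboolP Ha /asboolP Hb]; apply/asboolP => i j u.
  exact: raddf0.
by rewrite -[(a - b) j]/(a j - b j) -(Ha i j u) -(Hb i j u) -raddfB.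
Qed.
HB.instance Definition _ :=
  GRing.isZmodClosed.Build (dprod D) (@compatible I D) compatible_closed.

Definition lim : zmodType := subgrp (@compatible I D).

Definition lim_proj (i : I) : {additive lim -> D i} := dproj i \o val.

Fact lim_projP (i j : I) (u : mor i j) (a : lim) :
  fmap D u (lim_proj i a) = lim_proj j a.
Proof. by have /asboolP H := valP a; apply: H. Qed.

Fact lim_ext (a b : lim) : (forall i, lim_proj i a = lim_proj i b) -> a = b.
Proof.
by move=> ab; apply: val_inj; apply: functional_extensionality_dep.
Qed.

Variables (U : zmodType) (f : forall i, {additive U -> D i}).
Hypothesis fP : forall i j (u : mor i j) x, fmap D u (f i x) = f j x.

Definition lim_tuple_fun (x : U) : lim :=
  Sub (dtuple f x) (introT (asboolP _) (fun i j u => fP u x)).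

Fact lim_tuple_funB : {morph lim_tuple_fun : x y / x - y}.
Proof.
move=> x y; apply: lim_ext => i.
by rewrite raddfB /= raddfB.
Qed.

Definition lim_tuple : {additive U -> lim} := additive_of lim_tuple_funB.
End Limit.
Arguments lim_proj {I D} i.

Section DiagramLimit.
Variables (I C : category) (D : diagram I C).

Definition eval (x : C) : functor I :=
  @Functor I (fun i => D i x) (fun i j u => dmap D u x)
    (fun i a => dmap_id a) (fun i j k v u a => dmap_comp v u a).

Fact limF_subproof (x y : C) (f : mor x y) (i j : I) (u : mor i j)
    (a : lim (eval x)) :
  fmap (eval y) u ((fmap (D i) f \o lim_proj (D := eval x) i) a) =
  (fmap (D j) f \o lim_proj (D := eval x) j) a.
Proof. by rewrite /= naturality (lim_projP u a). Qed.

Definition limF : functor C.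
Proof.
exists (fun x => lim (eval x)) (fun x y f => lim_tuple (limF_subproof f)).
- by move=> x a; apply: lim_ext => i; rewrite /= fmap_id.
- by move=> x y z g f a; apply: lim_ext => i; rewrite /= fmap_comp.
Defined.

Definition limF_proj (i : I) : nattrans limF (D i) :=
  @NatTrans C limF (D i) (fun x => lim_proj i) (fun _ _ _ _ => erefl).
End DiagramLimit.

Section LimitMap.
Variables (I C : category) (D D' : diagram I C) (a : diagram_map D D').

Fact limF_map_subproof (x : C) (i j : I) (u : mor i j) (c : limF D x) :
  fmap (eval D' x) u ((a i x \o lim_proj (D := eval D x) i) c) =
  (a j x \o lim_proj (D := eval D x) j) c.
Proof. by rewrite /= -dnaturality (lim_projP u c). Qed.

Definition limF_map : nattrans (limF D) (limF D').
Proof.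
exists (fun x => lim_tuple (@limF_map_subproof x)).
by move=> x y f c; apply: lim_ext => i; rewrite /= naturality.
Defined.
End LimitMap.

Definition exact_limits (I C : category) : Prop :=
  forall (D1 D2 D3 : diagram I C) (a : diagram_map D1 D2) (b : diagram_map D2 D3),
    (forall i x, short_exact (a i x) (b i x)) ->
    forall x, short_exact (limF_map a x) (limF_map b x).

Section ProdFunctor.
Variables (C : category) (I : Type) (F : I -> functor C).

Definition prodF : functor C.
Proof.
exists (fun x => dprod (fun i => F i x))
  (fun x y f => dtuple (fun i => fmap (F i) f \o dproj i)).
- by move=> x a; apply: functional_extensionality_dep => i; rewrite /= fmap_id.
- by move=> x y z g f a; apply: functional_extensionality_dep => i;
    rewrite /= fmap_comp.
Defined.

Definition prodF_proj (i : I) : nattrans prodF (F i) :=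
  @NatTrans C prodF (F i) (fun x => dproj i) (fun _ _ _ _ => erefl).
End ProdFunctor.

Section Tensor.
Variable C : category.

Definition tensor_gen (L : functor C) (M : functor (opcat C)) : choiceType :=
  {classic {x : C & (L x * M x)%type}}.

Definition tgen (L : functor C) (M : functor (opcat C)) (x : C)
    (l : L x) (m : M x) : {freeg (tensor_gen L M)} :=
  << (existT _ x (l, m) : tensor_gen L M) >>.

(* The first two families of relations present the direct sum over x of the
   groups L x (x)_Z M x. *)
Inductive tensor_rel (L : functor C) (M : functor (opcat C)) :
    {freeg (tensor_gen L M)} -> Prop :=
| tensor_addl x (l l' : L x) (m : M x) :
    tensor_rel (tgen (l + l') m - (tgen l m + tgen l' m))
| tensor_addr x (l : L x) (m m' : M x) :
    tensor_rel (tgen l (m + m') - (tgen l m + tgen l m'))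
| tensor_balanced x y (f : mor x y) (l : L x) (m : M y) :
    tensor_rel (tgen (fmap L f l) m - tgen l (fmap M (f : @mor (opcat C) y x) m)).

Definition tensor (L : functor C) (M : functor (opcat C)) : zmodType :=
  quotgrp (@tensor_rel L M).

Definition pure (L : functor C) (M : functor (opcat C)) (x : C)
    (l : L x) (m : M x) : tensor L M := quot_pi _ (tgen l m).

Fact tensor_ext (L : functor C) (M : functor (opcat C)) (V : zmodType)
    (f g : {additive tensor L M -> V}) :
  (forall x (l : L x) (m : M x), f (pure l m) = g (pure l m)) -> f =1 g.
Proof.
move=> fg q; have [D <-] := quot_surj q.
pose p := additive_of (@quot_piB _ (@tensor_rel L M)).
apply: (@freeg_ext _ _ (f \o p) (g \o p)) => -[x [l m]]; exact: fg.
Qed.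

Section TensorMap.
Variables (L L' : functor C) (M M' : functor (opcat C)).
Variables (a : nattrans L L') (b : nattrans M M').

Definition tensor_gen_map (s : tensor_gen L M) : tensor_gen L' M' :=
  existT _ (projT1 s) (a _ (projT2 s).1, b _ (projT2 s).2).

Fact tensor_map_subproof (D : {freeg (tensor_gen L M)}) :
  tensor_rel D -> generated (@tensor_rel L' M') (freeg_map tensor_gen_map D).
Proof.
have E x (l : L x) (m : M x) :
    freeg_map tensor_gen_map (tgen l m) = tgen (a x l) (b x m).
  exact: freeg_mapU.
case=> [x l l' m|x l m m'|x y f l m]; apply: gen_in.
- by rewrite raddfB [freeg_map _ (_ + _)]raddfD !E raddfD; apply: tensor_addl.
- by rewrite raddfB [freeg_map _ (_ + _)]raddfD !E raddfD; apply: tensor_addr.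
- by rewrite raddfB !E !naturality; apply: tensor_balanced.
Qed.

Definition tensor_map : {additive tensor L M -> tensor L' M'} :=
  quot_map tensor_map_subproof.

Fact tensor_map_pure x (l : L x) (m : M x) :
  tensor_map (pure l m) = pure (a x l) (b x m).
Proof.
rewrite [LHS](quot_map_funE tensor_map_subproof); congr quot_pi.
exact: freeg_mapU.
Qed.
End TensorMap.
End Tensor.

Section Resolutions.
Variable C : category.

Definition projective (P : functor C) : Prop :=
  forall (F F' : functor C) (p : nattrans F F') (f : nattrans P F'),
    (forall x, surjective (p x)) ->
    exists g : nattrans P F, forall x a, p x (g x a) = f x a.

Record resolution (A : functor C) := Resolution {
  res :> nat -> functor C;
  res_proj : forall k, projective (res k);
  res_d : forall k, nattrans (res k.+1) (res k);
  res_aug : nattrans (res 0) A;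
  res_aug_surj : forall x, surjective (res_aug x);
  res_exact0 : forall x, exact (res_d 0 x) (res_aug x);
  res_exactS : forall k x, exact (res_d k.+1 x) (res_d k x) }.
Definition free_gen (F : functor C) (y : C) : choiceType :=
  {classic {x : C & (F x * mor x y)%type}}.

Definition free_gen_map (F : functor C) (y z : C) (f : mor y z)
    (s : free_gen F y) : free_gen F z :=
  existT _ (projT1 s) ((projT2 s).1, compose f (projT2 s).2).

(* The direct sum, over all x and all elements of F x, of the functors Z[x, -] *)
Definition freeF (F : functor C) : functor C.
Proof.
refine (@Functor C (fun y => {freeg (free_gen F y)})
  (fun y z f => freeg_map (@free_gen_map F y z f)) _ _).
- move=> x; apply: (@freeg_ext _ _ _ idfun) => -[y [a h]].
  by rewrite freeg_mapU /free_gen_map /= compose_idl.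
- move=> x y z g f.
  apply: (@freeg_ext _ _ _ (freeg_map _ \o freeg_map _)) => -[t [a h]].
  rewrite freeg_mapU.
  rewrite [RHS](congr1 (freeg_map (free_gen_map g)) (freeg_mapU _ _)).
  by rewrite freeg_mapU /free_gen_map /= compose_assoc.
Defined.

Definition freeF_lift (F F' : functor C) (u : forall x, F x -> F' x) :
  nattrans (freeF F) F'.
Proof.
refine (@NatTrans C (freeF F) F' (fun y => freeg_lift (fun s : free_gen F y =>
  fmap F' (projT2 s).2 (u _ (projT2 s).1))) _).
move=> x y f; apply: (@freeg_ext _ _ (freeg_lift _ \o freeg_map _)
  (fmap F' f \o freeg_lift _)) => -[t [a h]].
rewrite [LHS](congr1 (freeg_lift _) (freeg_mapU _ _)) freeg_liftU.
by rewrite [RHS](congr1 (fmap F' f) (freeg_liftU _ _)) /= fmap_comp.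
Defined.

Fact freeF_proj (F : functor C) : projective (freeF F).
Proof.
move=> H H' p f ps.
pose e x (a : F x) : freeF F x := << (existT _ x (a, idm x) : free_gen F x) >>.
pose u x (a : F x) : H x := sval (cid (ps x (f x (e x a)))).
exists (freeF_lift u) => x.
apply: (@freeg_ext _ _ (p x \o freeg_lift _) (f x)) => -[y [a h]].
rewrite [LHS](congr1 (p x) (freeg_liftU _ _)) /= naturality /u.
case: cid => b /= ->.
rewrite -[LHS](naturality f h (e y a)); congr (f x _).
by rewrite [LHS]freeg_mapU /free_gen_map /= compose_idr.
Qed.

Definition freeF_cover (F : functor C) : nattrans (freeF F) F :=
  freeF_lift (fun x a => a).

Fact freeF_cover_surj (F : functor C) x : surjective (freeF_cover F x).
Proof.
move=> a; exists << (existT _ x (a, idm x) : free_gen F x) >>.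
by rewrite [LHS]freeg_liftU /= fmap_id.
Qed.

Fact kerF_subproof (F F' : functor C) (p : nattrans F F') x y (f : mor x y) v :
  p x v = 0 -> p y (fmap F f v) = 0.
Proof. by move=> v0; rewrite naturality v0 raddf0. Qed.

Definition kerF (F F' : functor C) (p : nattrans F F') : functor C.
Proof.
refine (@Functor C (fun x => subgrp (kernel (p x)))
  (fun x y f => additive_of (ker_map_funB (@kerF_subproof _ _ p x y f))) _ _).
- by move=> x a; apply: val_inj; rewrite /= fmap_id.
- by move=> x y z g f a; apply: val_inj; rewrite /= fmap_comp.
Defined.

Definition kerF_val (F F' : functor C) (p : nattrans F F') :
    nattrans (kerF p) F :=
  @NatTrans C (kerF p) F
    (fun x => val : {additive subgrp (kernel (p x)) -> F x})
    (fun _ _ _ _ => erefl).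

Fixpoint syzygy (A : functor C) (k : nat) : functor C :=
  if k is k'.+1 then kerF (freeF_cover (syzygy A k')) else A.

Fact resolution_exists (A : functor C) : inhabited (resolution A).
Proof.
pose c k := freeF_cover (syzygy A k).
have cS k x := @freeF_cover_surj (syzygy A k) x.
constructor; refine (@Resolution A (fun k => freeF (syzygy A k))
  (fun k => @freeF_proj (syzygy A k))
  (fun k => nt_comp (kerF_val (c k)) (c k.+1)) (c 0) (cS 0) _ _) => [x v|k x v].
- split=> [v0|[u <-]]; last exact: (eqP (valP (c 1 x u))).
  have Hv : v \in kernel (c 0 x) by rewrite unfold_in v0.
  by have [u uE] := cS 1 x (Sub v Hv); exists u; exact: (congr1 val uE).
- split=> [v0|[u <-]].
    have v1 : c k.+1 x v = 0 by apply: val_inj.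
    have Hv : v \in kernel (c k.+1 x) by rewrite unfold_in v1.
    by have [u uE] := cS k.+2 x (Sub v Hv); exists u; exact: (congr1 val uE).
  have E : c k.+1 x (val (c k.+2 x u)) = 0 by exact/eqP/(valP (c k.+2 x u)).
  exact: (congr1 val E).
Qed.
End Resolutions.

(* Tor_*(L, A) is computed from a given projective resolution P of A. *)
Section Tor.
Variables (C : category) (A : functor (opcat C)) (P : resolution A).

Definition tor_d (L : functor C) (k : nat) :
    {additive tensor L (P k) -> tensor L (P k.-1)} :=
  match k with
  | 0 => \0
  | k'.+1 => tensor_map (nt_id L) (res_d P k')
  end.

Definition Tor (L : functor C) (k : nat) : zmodType :=
  homology (tor_d L k.+1) (tor_d L k).

Section TorMap.
Variables (L L' : functor C) (a : nattrans L L').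

Definition tor_chain (k : nat) : {additive tensor L (P k) -> tensor L' (P k)} :=
  tensor_map a (nt_id (P k)).

Fact tor_chainP k t :
  tor_d L' k (tor_chain k t) = tor_chain k.-1 (tor_d L k t).
Proof.
case: k t => [|k] t; first by rewrite [RHS]raddf0.
move: t; apply: (@tensor_ext C L (P k.+1) _ (tor_d L' k.+1 \o tor_chain k.+1)
  (tor_chain k \o tor_d L k.+1)) => x l m.
transitivity (tensor_map (nt_id L') (res_d P k)
  (tensor_map a (nt_id (P k.+1)) (pure l m))) => //.
transitivity (tensor_map a (nt_id (P k))
  (tensor_map (nt_id L) (res_d P k) (pure l m))) => //.
by rewrite !tensor_map_pure.
Qed.

Fact tor_map_ker k t : tor_d L k t = 0 -> tor_d L' k (tor_chain k t) = 0.
Proof. by move=> t0; rewrite tor_chainP t0 raddf0. Qed.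

Fact tor_map_im k u :
  exists u', tor_d L' k.+1 u' = tor_chain k (tor_d L k.+1 u).
Proof. by exists (tor_chain k.+1 u); rewrite tor_chainP. Qed.

Definition Tor_map (k : nat) : {additive Tor L k -> Tor L' k} :=
  homology_map (@tor_map_ker k) (@tor_map_im k).
End TorMap.

Fact Tor_map_comp (L1 L2 L3 : functor C) (b : nattrans L2 L3)
    (a : nattrans L1 L2) (c : nattrans L1 L3) (k : nat) :
  (forall x l, c x l = b x (a x l)) ->
  forall t, Tor_map c k t = Tor_map b k (Tor_map a k t).
Proof.
move=> cE t; have [z <-] := quot_surj t.
rewrite [Tor_map c k _]homology_mapE [Tor_map a k _]homology_mapE.
rewrite [Tor_map b k _]homology_mapE; congr quot_pi; apply: val_inj.
have H : tor_chain c k =1 tor_chain b k \o tor_chain a k.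
  apply: (@tensor_ext C L1 (P k) _ (tor_chain c k)
    (tor_chain b k \o tor_chain a k)) => x l m.
  transitivity (tor_chain b k (tor_chain a k (pure l m))) => //.
  by rewrite /tor_chain !tensor_map_pure cE.
rewrite !ker_map_funE; exact: (H (val z)).
Qed.

Fact Tor_map_id (L : functor C) (c : nattrans L L) (k : nat) :
  (forall x l, c x l = l) -> forall t, Tor_map c k t = t.
Proof.
move=> cE t; have [z <-] := quot_surj t.
rewrite [Tor_map c k _]homology_mapE; congr quot_pi; apply: val_inj.
have H : tor_chain c k =1 idfun.
  apply: (@tensor_ext C L (P k) _ (tor_chain c k) idfun) => x l m.
  by rewrite /tor_chain tensor_map_pure cE.
rewrite !ker_map_funE; exact: (H (val z)).
Qed.

Definition Tor_diagram (I : category) (N : diagram I C) (k : nat) : functor I :=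
  @Functor I (fun i => Tor (N i) k) (fun i j u => Tor_map (dmap N u) k)
    (fun i => Tor_map_id (k := k) (@dmap_id _ _ N i))
    (fun i j l v u => Tor_map_comp (k := k) (@dmap_comp _ _ N i j l v u)).

Fact Tor_lim_subproof (I : category) (N : diagram I C) (k : nat)
    (i j : I) (u : mor i j) (t : Tor (limF N) k) :
  fmap (Tor_diagram N k) u (Tor_map (limF_proj N i) k t) =
  Tor_map (limF_proj N j) k t.
Proof.
symmetry; apply: Tor_map_comp => x l; symmetry.
exact: (@lim_projP _ (eval N x)).
Qed.

(* Tor_k(lim N, A) -> lim Tor_k(N, A), induced by the projections of the limit *)
Definition Tor_lim (I : category) (N : diagram I C) (k : nat) :
    {additive Tor (limF N) k -> lim (Tor_diagram N k)} :=
  lim_tuple (@Tor_lim_subproof I N k).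

(* Tor_k(prod_i prod_l F i l, A) -> prod_i prod_l Tor_k(F i l, A) *)
Definition Tor_prod (I : Type) (J : I -> Type) (F : forall i, J i -> functor C)
    (k : nat) :
    {additive Tor (prodF (fun i => prodF (F i))) k ->
              dprod (fun i => dprod (fun j => Tor (F i j) k) : zmodType)} :=
  dtuple (fun i => dtuple (fun j =>
    Tor_map (nt_comp (prodF_proj (F i) j)
                     (prodF_proj (fun i => prodF (F i)) i)) k)).
End Tor.

(* The library's groupType is not used because every zmodType is also a
   groupType (to_multiplicative), so its carriers live in the universe of those
   of zmodType, whereas a tensor product over the orbit category, which is
   indexed by all transitive G-sets, is a zmodType only if the G-sets, hence
   also G, live in a strictly smaller universe. *)
Record group := Group {
  gcarrier :> Type;
  gmul : gcarrier -> gcarrier -> gcarrier;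
  gone : gcarrier;
  ginv : gcarrier -> gcarrier;
  gmulA : associative gmul;
  gmul1 : left_id gone gmul;
  gmulV : left_inverse gone ginv gmul }.
Arguments gone {g}.

Definition is_subgroup (G : group) (H : G -> Prop) : Prop :=
  [/\ H gone, forall x y, H x -> H y -> H (gmul x y) &
      forall x, H x -> H (ginv x)].

Definition conjugate (G : group) (g : G) (H : G -> Prop) : G -> Prop :=
  fun x => H (gmul (gmul (ginv g) x) g).

Record subgroup_family (G : group) := SubgroupFamily {
  fam :> (G -> Prop) -> Prop;
  fam_subgroup : forall H, fam H -> is_subgroup H;
  fam_conj : forall g H, fam H -> fam (conjugate g H) }.

Record gset (G : group) := GSet {
  gset_carrier :> Type;
  act : G -> gset_carrier -> gset_carrier;
  act1 : forall x, act gone x = x;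
  actM : forall g h x, act (gmul g h) x = act g (act h x) }.

Definition stabiliser (G : group) (D : gset G) (x : D) : G -> Prop :=
  fun g => act g x = x.

Definition stabilisers_in (G : group) (X : subgroup_family G) (D : gset G) :
    Prop :=
  forall x : D, X (stabiliser x).

Definition transitive_gset (G : group) (D : gset G) : Prop :=
  inhabited D /\ forall x y : D, exists g, act g x = y.

Record gmap (G : group) (D E : gset G) := GMap {
  gfun :> D -> E;
  gfun_act : forall g x, gfun (act g x) = act g (gfun x) }.

Fact gmap_ext (G : group) (D E : gset G) (f f' : gmap D E) :
  f =1 f' -> f = f'.
Proof.
case: f f' => [f Hf] [f' Hf'] /= ff'.
have {}ff' : f = f' by apply: functional_extensionality_dep.
move: Hf'; case: _ / ff' => Hf'; congr GMap; exact: Prop_irrelevance.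
Qed.

Definition gmap_id (G : group) (D : gset G) : gmap D D :=
  @GMap G D D id (fun _ _ => erefl).

Definition gmap_comp (G : group) (D E F : gset G) (f' : gmap E F) (f : gmap D E) :
  gmap D F.
Proof. by exists (f' \o f) => g x; rewrite /= !gfun_act. Defined.

Section GroupTheory.
Variable G : group.
Implicit Types x y z : G.

Fact gmulKV x y : gmul (ginv x) (gmul x y) = y.
Proof. by rewrite gmulA gmulV gmul1. Qed.

Fact gmulVr x : gmul x (ginv x) = gone.
Proof. by rewrite -[LHS](gmulKV (ginv x)) [gmul (ginv x) _]gmulKV gmulV. Qed.

Fact gmulr1 x : gmul x gone = x.
Proof. by rewrite -(gmulV x) gmulA gmulVr gmul1. Qed.

Fact gmulK x y : gmul x (gmul (ginv x) y) = y.
Proof. by rewrite gmulA gmulVr gmul1. Qed.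

Fact ginvM x y : ginv (gmul x y) = gmul (ginv y) (ginv x).
Proof.
rewrite -[RHS](gmulKV (gmul x y)) -[gmul (gmul x y) _]gmulA gmulK gmulVr.
by rewrite gmulr1.
Qed.

Fact ginv1 : ginv gone = gone :> G.
Proof. by rewrite -[LHS]gmul1 gmulVr. Qed.
End GroupTheory.

Section Cosets.
Variables (G : group) (K : G -> Prop).

Definition lcoset (g : G) : G -> Prop := fun x => K (gmul (ginv g) x).

Definition coset : Type := {A : G -> Prop | exists g, A = lcoset g}.

Fact coset_ext (a b : coset) : (forall x, sval a x <-> sval b x) -> a = b.
Proof.
case: a b => [a Ha] [b Hb] /= ab; have {}ab : a = b.
  by apply: functional_extensionality_dep => x; apply: propext.
by move: Hb; case: _ / ab => Hb; congr exist; apply: Prop_irrelevance.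
Qed.

Fact coset_act_subproof (g : G) (a : coset) :
  exists h, (fun x => sval a (gmul (ginv g) x)) = lcoset h.
Proof.
have [h ->] := svalP a; exists (gmul g h).
by apply: functional_extensionality_dep => x; rewrite /lcoset ginvM gmulA.
Qed.

Definition coset_act (g : G) (a : coset) : coset :=
  exist _ (fun x => sval a (gmul (ginv g) x)) (coset_act_subproof g a).

Fact coset_act1 a : coset_act gone a = a.
Proof. by apply: coset_ext => x; rewrite /= ginv1 gmul1. Qed.

Fact coset_actM g h a : coset_act (gmul g h) a = coset_act g (coset_act h a).
Proof. by apply: coset_ext => x; rewrite /= ginvM gmulA. Qed.

(* G/K, with the action g (h K) = (g h) K *)
Definition coset_gset : gset G := GSet coset_act1 coset_actM.

Hypothesis subK : is_subgroup K.

Fact coset_gset_transitive : transitive_gset coset_gset.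
Proof.
split=> [|a b]; first by constructor; exists (lcoset gone), gone.
have [[g ag] [h bh]] := (svalP a, svalP b).
exists (gmul h (ginv g)); apply: coset_ext => x.
by rewrite /= ag bh /lcoset ginvM -gmulA gmulK.
Qed.

Fact coset_stabiliser (g : G) (a : coset_gset) :
  sval a = lcoset g -> stabiliser a = conjugate g K.
Proof.
case: subK => K1 KM KV aE; apply: functional_extensionality_dep => h.
apply: propext; split=> [/(congr1 (fun b : coset => sval b (gmul h g)))|Kh].
  rewrite /= aE /lcoset gmulKV gmulV => H.
  by rewrite /conjugate -gmulA -H.
apply: coset_ext => x; rewrite /= aE /lcoset.
have E : gmul (ginv g) x =
    gmul (gmul (gmul (ginv g) h) g) (gmul (ginv g) (gmul (ginv h) x)).
  by rewrite -!gmulA gmulK gmulK.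
split=> H; first by rewrite E; apply: KM.
rewrite -(gmulKV (gmul (gmul (ginv g) h) g) (gmul _ _)) -E.
by apply: KM => //; apply: KV.
Qed.
End Cosets.

Section OrbitCategory.
Variables (G : group) (X : subgroup_family G).

Record orbit := Orbit {
  orbit_gset :> gset G;
  orbit_transitive : transitive_gset orbit_gset;
  orbit_stabilisers : stabilisers_in X orbit_gset }.

Definition orbit_cat : category.
Proof.
exists orbit (fun D E => gmap D E) (fun D => gmap_id D)
  (fun D E F f' f => gmap_comp f' f); by move=> *; apply: gmap_ext.
Defined.

Definition module := functor (opcat orbit_cat).
Definition comodule := functor orbit_cat.

Definition Zmaps (D E : gset G) : zmodType := {freeg {classic gmap D E}}.

Definition Zpost (D E F : gset G) (f : gmap E F) :
    {additive Zmaps D E -> Zmaps D F} :=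
  freeg_map ((fun u => gmap_comp f u) : {classic gmap D E} -> {classic gmap D F}).

Definition Zpre (D E F : gset G) (f : gmap D E) :
    {additive Zmaps E F -> Zmaps D F} :=
  freeg_map ((fun u => gmap_comp u f) : {classic gmap E F} -> {classic gmap D F}).

(* Z[-, D].  A G-map out of a transitive G-set lands in a single orbit of D, so
   for arbitrary D this is the direct sum of the Z[-, O] over the orbits O. *)
Definition free_module (D : gset G) : module.
Proof.
refine (@Functor (opcat orbit_cat) (fun E : orbit => Zmaps E D)
  (fun (E E' : orbit) (f : gmap E' E) => Zpre D f) _ _).
- move=> E; apply: (@freeg_ext _ _ _ idfun) => u.
  by rewrite freeg_mapU; congr << _ >>; apply: gmap_ext.
- move=> E E' E'' g f; apply: (@freeg_ext _ _ _ (Zpre D g \o Zpre D f)) => u.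
  rewrite freeg_mapU [RHS](congr1 (Zpre D g) (freeg_mapU _ u)) freeg_mapU.
  by congr << _ >>; apply: gmap_ext.
Defined.

Definition free_comodule (D : orbit) : comodule.
Proof.
refine (@Functor orbit_cat (fun E : orbit => Zmaps D E)
  (fun (E E' : orbit) (f : gmap E E') => Zpost D f) _ _).
- move=> E; apply: (@freeg_ext _ _ _ idfun) => u.
  by rewrite freeg_mapU; congr << _ >>; apply: gmap_ext.
- move=> E E' E'' g f; apply: (@freeg_ext _ _ _ (Zpost D g \o Zpost D f)) => u.
  rewrite freeg_mapU [RHS](congr1 (Zpost D g) (freeg_mapU _ u)) freeg_mapU.
  by congr << _ >>; apply: gmap_ext.
Defined.

Fact coset_gset_stabilisers (K : {K : G -> Prop | X K}) :
  stabilisers_in X (coset_gset (sval K)).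
Proof.
case: K => K XK [a [g aE]]; rewrite (@coset_stabiliser _ _ _ g) //.
  exact: fam_conj.
exact: fam_subgroup XK.
Qed.

Definition coset_orbit (K : {K : G -> Prop | X K}) : orbit :=
  Orbit (coset_gset_transitive (sval K)) (@coset_gset_stabilisers K).

Definition finitely_many_orbits (D : gset G) : Prop :=
  exists (m : nat) (r : 'I_m -> D), forall x, exists i g, act g (r i) = x.

Definition finitely_generated (M : module) : Prop :=
  exists D : gset G, [/\ stabilisers_in X D, finitely_many_orbits D &
    exists p : nattrans (free_module D) M, forall E, surjective (p E)].
End OrbitCategory.

(* In the following n : option nat stands for an element of {0, 1, ..., oo},
   with None for oo. *)
Definition Bredon_FP (G : group) (X : subgroup_family G) (n : option nat)
    (A : module X) : Prop :=
  exists P : resolution A,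
    forall i, (if n is Some m then (i <= m)%N else true) ->
    finitely_generated (P i).

Definition iso_below_epi_at (n : option nat) (T T' : nat -> zmodType)
    (f : forall k, {additive T k -> T' k}) : Prop :=
  (forall k, (if n is Some m then (k < m)%N else true) -> bijective (f k)) /\
  (forall k, n = Some k -> surjective (f k)).

Definition Tor_commutes_exact_limits (G : group) (X : subgroup_family G)
    (n : option nat) (A : module X) (P : resolution A) : Prop :=
  forall (I : category) (N : diagram I (orbit_cat X)),
    exact_limits I (orbit_cat X) -> iso_below_epi_at n (Tor_lim P N).

Definition Tor_commutes_free_products (G : group) (X : subgroup_family G)
    (n : option nat) (A : module X) (P : resolution A) : Prop :=
  forall L : {K : G -> Prop | X K} -> Type,
    iso_below_epi_at n
      (Tor_prod P (fun K (_ : L K) => free_comodule (coset_orbit K))).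

(* Main.v *)
(* A finitely generated projective module M is a direct summand of a finite sum
   of modules Z[-, D_j], and L (x) Z[-, D] = L(D), so the functor - (x) M commutes
   with all limits.  Given a resolution that is finitely generated up to degree
   n, the homology of the tensored complex therefore commutes with exact limits
   in the required range; the choice of the resolution does not matter since any
   two are chain homotopy equivalent.  Products are exact limits.  Conversely,
   resolve A by covers that are finitely generated whenever the covered syzygy
   is.  If the first k covers are finitely generated, the hypothesis on Tor_k and
   Tor_(k-1) shows that B (the k-th syzygy) satisfies: every element of
   prod_i (N_i (x) B) comes from (prod_i N_i) (x) B.  For the family of all
   elements of B(G/K), K in X, this exhibits a finite generating set of B. *)
From HB Require Import structures.
From mathcomp Require Import all_boot all_algebra generic_quotient.
From mathcomp Require Import boolp.
From mathcomp.multinomials Require Import freeg.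
Require Import Defs.

Set Implicit Arguments.
Unset Strict Implicit.
Unset Printing Implicit Defensive.

Import GRing.Theory.
Local Open Scope ring_scope.

(** * Quotients, homology classes and tensor products *)

Lemma bij_inj_surj (S T : Type) (f : S -> T) :
  bijective f <-> injective f /\ surjective f.
Proof.
split=> [bf|[fi fs]].
  by split=> [|y]; [exact: bij_inj | case: bf => g _ K; exists (g y)].
exists (fun y => sval (cid (fs y))) => x; last by case: cid.
by case: cid => z /= /fi.
Qed.

Section QuotLift.
Variables (V W : zmodType) (R : V -> Prop) (f : {additive V -> W}).
Hypothesis fR : forall x, R x -> f x = 0.

Lemma generated_eq0 x : generated R x -> f x = 0.
Proof.
elim=> [y /fR //||y z _ fy _ fz]; first exact: raddf0.
by rewrite raddfB fy fz subrr.
Qed.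

Definition quot_lift_fun (q : quotgrp R) : W := f (repr q).

Lemma quot_lift_funE x : quot_lift_fun (quot_pi R x) = f x.
Proof.
apply/eqP; rewrite -subr_eq0 -raddfB; apply/eqP/generated_eq0/quot_piP.
by rewrite /quot_pi reprK.
Qed.

Lemma quot_lift_funB : {morph quot_lift_fun : x y / x - y}.
Proof.
move=> p q; have [x <-] := quot_surj p; have [y <-] := quot_surj q.
by rewrite -quot_piB !quot_lift_funE raddfB.
Qed.

Definition quot_lift : {additive quotgrp R -> W} := additive_of quot_lift_funB.

Lemma quot_liftE x : quot_lift (quot_pi R x) = f x.
Proof. exact: quot_lift_funE. Qed.
End QuotLift.

Definition quot_proj (V : zmodType) (R : V -> Prop) : {additive V -> quotgrp R} :=
  additive_of (@quot_piB V R).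

Section HomologyClass.
Variables (U V W : zmodType) (f : {additive U -> V}) (g : {additive V -> W}).

Lemma ker_in v : g v = 0 -> v \in kernel g.
Proof. by move=> gv; rewrite unfold_in gv. Qed.

Lemma kerE (z : subgrp (kernel g)) : g (val z) = 0.
Proof. exact/eqP/(valP z). Qed.

Definition ker_elt (v : V) (gv : g v = 0) : subgrp (kernel g) := Sub v (ker_in gv).

Lemma val_ker_elt v (gv : g v = 0) : val (ker_elt gv) = v.
Proof. exact: SubK. Qed.

Lemma val_kerB (z z' : subgrp (kernel g)) : val (z - z') = val z - val z'.
Proof. exact: raddfB. Qed.

Definition hclass (v : V) (gv : g v = 0) : homology f g := quot_pi _ (ker_elt gv).

Lemma hclassP (h : homology f g) : exists v (gv : g v = 0), h = hclass gv.
Proof.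
have [z <-] := quot_surj h; exists (val z), (kerE z).
by congr quot_pi; apply: val_inj; rewrite val_ker_elt.
Qed.

Lemma hclass_eq v v' (gv : g v = 0) (gv' : g v' = 0) :
  hclass gv = hclass gv' <-> exists u, f u = v - v'.
Proof.
have E : v - v' = val (ker_elt gv - ker_elt gv') by rewrite val_kerB !val_ker_elt.
split=> [/quot_piP|[u fu]]; last by apply/quot_piP/gen_in; exists u; rewrite -E.
(* Boundaries already form a subgroup, so generating a subgroup from them adds nothing. *)
rewrite E; elim=> [z [u fu]||z z' _ [u fu] _ [u' fu']]; first by exists u.
  by exists 0; rewrite raddf0 -(subrr (ker_elt gv)) val_kerB subrr.
by exists (u - u'); rewrite raddfB fu fu' val_kerB.
Qed.

Lemma hclass_eq0 v (gv : g v = 0) : hclass gv = 0 <-> exists u, f u = v.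
Proof.
have -> : 0 = hclass (raddf0 g).
  rewrite -(subrr (hclass gv)) -quot_piB; congr quot_pi.
  by apply: val_inj; rewrite val_kerB subrr val_ker_elt.
by split=> [/hclass_eq|] [u fu]; [|apply/hclass_eq]; exists u; rewrite fu subr0.
Qed.
End HomologyClass.

Lemma homology_map_hclass (U V W U' V' W' : zmodType)
    (f : {additive U -> V}) (g : {additive V -> W})
    (f' : {additive U' -> V'}) (g' : {additive V' -> W'}) (b : {additive V -> V'})
    (bk : forall v, g v = 0 -> g' (b v) = 0)
    (bi : forall u, exists u', f' u' = b (f u)) v (gv : g v = 0) :
  homology_map bk bi (hclass f gv) = hclass f' (bk v gv).
Proof.
rewrite [LHS]homology_mapE; congr quot_pi; apply: val_inj.
by rewrite ker_map_funE !val_ker_elt.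
Qed.

Section Tensor.
Variable C : category.
Implicit Types (L : functor C) (M : functor (opcat C)).

Section Bilinear.
Variables (L : functor C) (M : functor (opcat C)).

Lemma pure_is_additivel x (m : M x) : {morph (fun l : L x => pure l m) : l l' / l - l'}.
Proof.
have D l l' : pure (l + l') m = pure l m + pure l' m.
  rewrite /pure -[RHS](raddfD (quot_proj _)); apply/quot_piP/gen_in.
  exact: tensor_addl.
by move=> l l'; apply/eqP; rewrite eq_sym subr_eq -D subrK.
Qed.

Lemma pure_is_additiver x (l : L x) : {morph (fun m : M x => pure l m) : m m' / m - m'}.
Proof.
have D m m' : pure l (m + m') = pure l m + pure l m'.
  rewrite /pure -[RHS](raddfD (quot_proj _)); apply/quot_piP/gen_in.
  exact: tensor_addr.
by move=> m m'; apply/eqP; rewrite eq_sym subr_eq -D subrK.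
Qed.

Definition purel x (m : M x) : {additive L x -> tensor L M} :=
  additive_of (pure_is_additivel m).
Definition purer x (l : L x) : {additive M x -> tensor L M} :=
  additive_of (pure_is_additiver l).

Lemma pure_balanced x y (f : mor x y) (l : L x) (m : M y) :
  pure (fmap L f l) m = pure l (fmap M (f : @mor (opcat C) y x) m).
Proof. exact/quot_piP/gen_in/tensor_balanced. Qed.

Section Lift.
Variables (V : zmodType) (h : forall x, L x -> M x -> V).
Hypothesis hDl : forall x (l l' : L x) m, h (l + l') m = h l m + h l' m.
Hypothesis hDr : forall x (l : L x) (m m' : M x), h l (m + m') = h l m + h l m'.
Hypothesis hbal : forall x y (f : mor x y) (l : L x) (m : M y),
  h (fmap L f l) m = h l (fmap M (f : @mor (opcat C) y x) m).

Definition gen_lift : {additive {freeg (tensor_gen L M)} -> V} :=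
  freeg_lift (fun s : tensor_gen L M => h (projT2 s).1 (projT2 s).2).

Lemma gen_lift_rel D : tensor_rel D -> gen_lift D = 0.
Proof.
have E x (l : L x) (m : M x) : gen_lift (tgen l m) = h l m by exact: freeg_liftU.
case=> [x l l' m|x l m m'|x y f l m].
- by rewrite raddfB [gen_lift (_ + _)]raddfD !E hDl subrr.
- by rewrite raddfB [gen_lift (_ + _)]raddfD !E hDr subrr.
- by rewrite raddfB !E hbal subrr.
Qed.

Definition tensor_lift : {additive tensor L M -> V} := quot_lift gen_lift_rel.

Lemma tensor_lift_pure x (l : L x) (m : M x) : tensor_lift (pure l m) = h l m.
Proof. by rewrite [LHS]quot_liftE [LHS]freeg_liftU. Qed.
End Lift.

(** A representative in the free abelian group is a finite integer combination of generators; the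
    integers are absorbed into the left factors. *)
Lemma tensor_finite_sum (t : tensor L M) :
  exists (m : nat) (y : 'I_m -> C) (l : forall j, L (y j)) (q : forall j, M (y j)),
    t = \sum_j pure (l j) (q j).
Proof.
have [D <-] := quot_surj t.
pose s (j : 'I_(size (dom D))) : tensor_gen L M := tnth (in_tuple (dom D)) j.
exists (size (dom D)), (fun j => projT1 (s j)).
exists (fun j => (projT2 (s j)).1 *~ coeff (s j) D), (fun j => (projT2 (s j)).2).
rewrite -{1}(freeg_sumE D) -[LHS]/(quot_proj _ _) raddf_sum big_tnth.
apply: eq_bigr => j _; rewrite -/(s j).
rewrite -[LHS]/(quot_proj _ _) -[coeff (s j) D]intz -freegU_mulz raddfMz.
rewrite -[RHS]/(purel _ _) raddfMz intz; congr (_ *~ _).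
by rewrite /pure /tgen /quot_proj /=; case: (s j) => x [].
Qed.
End Bilinear.

Lemma tensor_map_add L L' M M' (a : nattrans L L') (b b1 b2 : nattrans M M') :
  (forall x m, b x m = b1 x m + b2 x m) ->
  forall t, tensor_map a b t = tensor_map a b1 t + tensor_map a b2 t.
Proof.
move=> bE; apply: (@tensor_ext _ _ _ _ _ (tensor_map a b1 \+ tensor_map a b2)) => x l m.
rewrite -[RHS]/(tensor_map a b1 (pure l m) + tensor_map a b2 (pure l m)).
by rewrite !tensor_map_pure bE -[pure _ (_ + _)]/(purer _ _ _) raddfD.
Qed.

Lemma tensor_map_comp L L' L'' M M' M'' (a : nattrans L L') (a' : nattrans L' L'')
    (b : nattrans M M') (b' : nattrans M' M'')
    (a'' : nattrans L L'') (b'' : nattrans M M'') :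
  (forall x l, a'' x l = a' x (a x l)) -> (forall x m, b'' x m = b' x (b x m)) ->
  forall t, tensor_map a'' b'' t = tensor_map a' b' (tensor_map a b t).
Proof.
move=> aE bE.
apply: (@tensor_ext _ _ _ _ _ (tensor_map a' b' \o tensor_map a b)) => x l m.
rewrite -[RHS]/(tensor_map a' b' (tensor_map a b (pure l m))).
by rewrite !tensor_map_pure aE bE.
Qed.

Lemma tensor_map_id L M (a : nattrans L L) (b : nattrans M M) :
  (forall x l, a x l = l) -> (forall x m, b x m = m) ->
  forall t, tensor_map a b t = t.
Proof.
move=> aE bE; apply: (@tensor_ext _ _ _ _ _ idfun) => x l m.
by rewrite tensor_map_pure aE bE.
Qed.

(** Covers the degenerate case of an empty family of subgroups, where the orbit category has no
    objects. *)
Lemma tensor_eq0 L M (t : tensor L M) : ~ inhabited C -> t = 0.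
Proof.
move=> C0; apply: (@tensor_ext _ _ _ _ idfun \0) => x.
by case: C0; constructor.
Qed.
End Tensor.

(** * Comparison of resolutions *)

Section NatTransSub.
Variables (C : category) (F F' : functor C) (a b : nattrans F F').

Lemma nt_sub_subproof x : {morph (fun u => a x u - b x u) : u v / u - v}.
Proof. by move=> u v; rewrite !raddfB addrACA. Qed.

Definition nt_sub : nattrans F F'.
Proof.
exists (fun x => additive_of (@nt_sub_subproof x)) => x y f u.
by rewrite /= !naturality raddfB.
Defined.
End NatTransSub.

(** Both [d] and [f] factor through the kernel of [e]. By exactness [d] becomes pointwise surjective
    there, so projectivity of [P] provides the lift. *)
Lemma projective_lift_exact (C : category) (P F1 F2 F3 : functor C)
    (d : nattrans F1 F2) (e : nattrans F2 F3) (f : nattrans P F2) :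
  projective P -> (forall x, exact (d x) (e x)) -> (forall x a, e x (f x a) = 0) ->
  exists g : nattrans P F1, forall x a, d x (g x a) = f x a.
Proof.
move=> pP de ef.
have corestrict (F : functor C) (h : nattrans F F2) (eh : forall x a, e x (h x a) = 0) :
    {h' : nattrans F (kerF e) | forall x a, val (h' x a) = h x a}.
  have hB x : {morph (fun a => ker_elt (eh x a)) : a b / a - b}.
    by move=> a b; apply: val_inj; rewrite val_kerB !val_ker_elt raddfB.
  have hN x y (u : mor x y) a :
      additive_of (hB y) (fmap F u a) = fmap (kerF e) u (additive_of (hB x) a).
    apply: val_inj; rewrite [LHS]val_ker_elt naturality.
    by rewrite -[X in fmap _ _ X](val_ker_elt (eh x a)).
  exists (@NatTrans C F (kerF e) (fun x => additive_of (hB x)) hN) => x a.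
  by rewrite [LHS]val_ker_elt.
have [d' d'E] := corestrict _ d (fun x a => proj2 (de x (d x a)) (ex_intro _ a erefl)).
have [f' f'E] := corestrict _ f ef.
have d'surj x : surjective (d' x).
  move=> z; have [a da] := proj1 (de x (val z)) (kerE z).
  by exists a; apply: val_inj; rewrite d'E.
have [g gE] := pP _ _ d' f' d'surj.
by exists g => x a; rewrite -d'E gE f'E.
Qed.

Section ChainMap.
Variables (C : category) (A : functor C) (P Q : resolution A).

(** Treats the augmentation as the differential leaving degree 0, so that one exactness statement
    serves every inductive step. *)
Definition res_target (R : resolution A) (k : nat) : functor C :=
  if k is k'.+1 then R k' else A.

Definition res_diff (R : resolution A) (k : nat) : nattrans (R k) (res_target R k) :=
  match k with 0 => res_aug R | k'.+1 => res_d R k' end.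

Lemma res_diff_exact (R : resolution A) k x : exact (res_d R k x) (res_diff R k x).
Proof. by case: k => [|k]; [exact: res_exact0 | exact: res_exactS]. Qed.

Lemma res_dd (R : resolution A) k x (a : R k.+1 x) : res_diff R k x (res_d R k x a) = 0.
Proof. by apply: (proj2 (res_diff_exact _)); exists a. Qed.

(** Invariant of the recursion: [f] after the differential of [P] lands in the cycles of [Q], hence
    lifts to the next degree. *)
Definition chain_extends k (f : nattrans (P k) (Q k)) :=
  forall x a, res_diff Q k x (f x (res_d P k x a)) = 0.

Lemma chain_map0 :
  {f : nattrans (P 0) (Q 0) | forall x a, res_aug Q x (f x a) = res_aug P x a}.
Proof.
apply: cid; exact: (@res_proj _ _ P 0 _ _ (res_aug Q) (res_aug P) (@res_aug_surj _ _ Q)).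
Qed.

Lemma chain_map0_extends : chain_extends (sval chain_map0).
Proof. by move=> x a; rewrite [LHS](svalP chain_map0) (res_dd (R := P) (k := 0)). Qed.

Lemma chain_map_step k (f : nattrans (P k) (Q k)) : chain_extends f ->
  {g : nattrans (P k.+1) (Q k.+1) |
    forall x a, res_d Q k x (g x a) = f x (res_d P k x a)}.
Proof.
move=> ef; apply: cid.
exact: (@projective_lift_exact _ _ _ _ _ _ (res_diff Q k) (nt_comp f (res_d P k))
  (@res_proj _ _ P k.+1) (@res_diff_exact Q k) ef).
Qed.

Lemma chain_map_step_extends k (f : nattrans (P k) (Q k)) (ef : chain_extends f) :
  chain_extends (sval (chain_map_step ef)).
Proof.
by move=> x a; rewrite [LHS](svalP (chain_map_step ef)) [res_d P k x _]res_dd raddf0.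
Qed.

Fixpoint chain_map_rec k : {f : nattrans (P k) (Q k) | chain_extends f} :=
  match k with
  | 0 => exist _ _ chain_map0_extends
  | k'.+1 => exist _ _ (chain_map_step_extends (svalP (chain_map_rec k')))
  end.

Definition chain_map k : nattrans (P k) (Q k) := sval (chain_map_rec k).

Lemma chain_map_aug x a : res_aug Q x (chain_map 0 x a) = res_aug P x a.
Proof. exact: (svalP chain_map0). Qed.

Lemma chain_mapP k x a :
  res_d Q k x (chain_map k.+1 x a) = chain_map k x (res_d P k x a).
Proof. exact: (svalP (chain_map_step (svalP (chain_map_rec k)))). Qed.
End ChainMap.

Section Homotopy.
Variables (C : category) (A : functor C) (P : resolution A).
Variable h : forall k, nattrans (P k) (P k).
Hypothesis h_aug : forall x a, res_aug P x (h 0 x a) = 0.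
Hypothesis hP : forall k x a, res_d P k x (h k.+1 x a) = h k x (res_d P k x a).

(** Invariant of the recursion: the part of [h] not yet accounted for by [s] takes values in cycles,
    hence by exactness in boundaries. *)
Definition homotopy_extends k (s : nattrans (P k) (P k.+1)) :=
  forall x a, res_d P k x (h k.+1 x a - s x (res_d P k x a)) = 0.

Lemma homotopy0 :
  {s : nattrans (P 0) (P 1) | forall x a, res_d P 0 x (s x a) = h 0 x a}.
Proof.
apply: cid.
exact: (@projective_lift_exact _ _ _ _ _ _ (res_aug P) (h 0)
  (@res_proj _ _ P 0) (@res_exact0 _ _ P) h_aug).
Qed.

Lemma homotopy0_extends : homotopy_extends (sval homotopy0).
Proof. by move=> x a; rewrite raddfB hP (svalP homotopy0) subrr. Qed.

Lemma homotopy_step k (s : nattrans (P k) (P k.+1)) : homotopy_extends s ->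
  {s' : nattrans (P k.+1) (P k.+2) |
    forall x a, res_d P k.+1 x (s' x a) = h k.+1 x a - s x (res_d P k x a)}.
Proof.
move=> es; apply: cid.
exact: (@projective_lift_exact _ _ _ _ _ _ (res_d P k)
  (nt_sub (h k.+1) (nt_comp s (res_d P k)))
  (@res_proj _ _ P k.+1) (@res_exactS _ _ P k) es).
Qed.

Lemma homotopy_step_extends k (s : nattrans (P k) (P k.+1)) (es : homotopy_extends s) :
  homotopy_extends (sval (homotopy_step es)).
Proof.
move=> x a; rewrite raddfB hP (svalP (homotopy_step es)).
by rewrite [res_d P k x _](@res_dd _ _ P k.+1) raddf0 subr0 subrr.
Qed.

Fixpoint homotopy_rec k : {s : nattrans (P k) (P k.+1) | homotopy_extends s} :=
  match k with
  | 0 => exist _ _ homotopy0_extends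
  | k'.+1 => exist _ _ (homotopy_step_extends (svalP (homotopy_rec k')))
  end.

Lemma null_homotopic :
  exists s : forall k, nattrans (P k) (P k.+1),
    (forall x a, h 0 x a = res_d P 0 x (s 0 x a)) /\
    (forall k x a, h k.+1 x a = res_d P k.+1 x (s k.+1 x a) + s k x (res_d P k x a)).
Proof.
exists (fun k => sval (homotopy_rec k)); split=> [x a|k x a].
  by rewrite (svalP homotopy0).
by rewrite [res_d P k.+1 x _](svalP (homotopy_step (svalP (homotopy_rec k)))) subrK.
Qed.
End Homotopy.

Section Comparison.
Variables (C : category) (A : functor (opcat C)).
Implicit Types (P Q : resolution A) (L : functor C).

Lemma tor_dd P L k t : tor_d P L k (tor_d P L k.+1 t) = 0.
Proof.
case: k t => [|k] t //; rewrite -[RHS]/((\0 : {additive _ -> _}) t).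
apply: (@tensor_ext _ _ _ _ (tor_d P L k.+1 \o tor_d P L k.+2) \0) => x l m.
rewrite -[LHS]/(tensor_map (nt_id L) (res_d P k)
  (tensor_map (nt_id L) (res_d P k.+1) (pure l m))).
rewrite !tensor_map_pure (@res_dd _ _ P k.+1).
by rewrite -[LHS]/(purer _ _ _) raddf0.
Qed.

Section CompareMap.
Variables (P Q : resolution A) (L : functor C).
Definition compare_chain k : {additive tensor L (P k) -> tensor L (Q k)} :=
  tensor_map (nt_id L) (chain_map P Q k).

Lemma compare_chainP k t :
  tor_d Q L k (compare_chain k t) = compare_chain k.-1 (tor_d P L k t).
Proof.
case: k t => [|k] t; first by rewrite [RHS]raddf0.
have E := @tensor_map_comp _ _ _ _ _ _ _ (nt_id L) (nt_id L).
transitivity (tensor_map (nt_id L) (nt_comp (chain_map P Q k) (res_d P k)) t).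
  by symmetry; apply: E => // x m; rewrite chain_mapP.
exact: E.
Qed.

Lemma compare_ker k t : tor_d P L k t = 0 -> tor_d Q L k (compare_chain k t) = 0.
Proof. by move=> t0; rewrite compare_chainP t0 raddf0. Qed.

Lemma compare_im k u :
  exists u', tor_d Q L k.+1 u' = compare_chain k (tor_d P L k.+1 u).
Proof. by exists (compare_chain k.+1 u); rewrite compare_chainP. Qed.

Definition compare k : {additive Tor P L k -> Tor Q L k} :=
  homology_map (@compare_ker k) (@compare_im k).
End CompareMap.

(** On chains, both composites are the tensor product of [a] with the comparison map. *)
Lemma compare_natural P Q L L' (a : nattrans L L') k t :
  compare P Q L' k (Tor_map P a k t) = Tor_map Q a k (compare P Q L k t).
Proof.
have [v [gv ->]] := hclassP t.
rewrite [Tor_map P _ _ _]homology_map_hclass [compare P Q L k _]homology_map_hclass.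
rewrite [LHS]homology_map_hclass [RHS]homology_map_hclass.
congr quot_pi; apply: val_inj; rewrite !val_ker_elt.
rewrite -[LHS](tensor_map_comp (a'' := a) (b'' := chain_map P Q k)) //.
by rewrite -[RHS](tensor_map_comp (a'' := a) (b'' := chain_map P Q k)).
Qed.

(** The composite chain map differs from the identity by a null-homotopic map, and on cycles such a
    map takes values in boundaries. *)
Lemma compareK P Q L k : cancel (compare P Q L k) (compare Q P L k).
Proof.
move=> t; have [v [gv ->]] := hclassP t; clear t.
rewrite [compare P Q L k _]homology_map_hclass [LHS]homology_map_hclass.
apply/hclass_eq.
(* Composite and identity both cover the identity of [A], so [h] covers zero. *)
pose h k := nt_sub (nt_comp (chain_map Q P k) (chain_map P Q k)) (nt_id (P k)).
have [|i x a|s [s0 sS]] := @null_homotopic _ _ P h.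
- by move=> x a; rewrite raddfB !chain_map_aug subrr.
- by rewrite raddfB /= !chain_mapP.
have hE : compare_chain Q P L k (compare_chain P Q L k v) - v =
    tensor_map (nt_id L) (h k) v.
  apply/eqP; rewrite subr_eq; apply/eqP.
  rewrite -[X in _ = _ + X](tensor_map_id (a := nt_id L) (b := nt_id _)) //.
  rewrite -(@tensor_map_add _ _ _ _ _ _
    (nt_comp (chain_map Q P k) (chain_map P Q k))); last first.
    by move=> x m; rewrite /= subrK.
  by rewrite [RHS](@tensor_map_comp _ _ _ _ _ _ _ (nt_id L) (nt_id L)
    (chain_map P Q k) (chain_map Q P k)).
exists (tensor_map (nt_id L) (s k) v); rewrite hE.
case: k v gv {hE} => [|k] v gv.
  by rewrite [RHS](@tensor_map_comp _ _ _ _ _ _ _ (nt_id L) (nt_id L) (s 0) (res_d P 0)).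
rewrite (@tensor_map_add _ _ _ _ _ _ _ (nt_comp (res_d P k.+1) (s k.+1))
  (nt_comp (s k) (res_d P k)) (sS k)).
rewrite (@tensor_map_comp _ _ _ _ _ _ _ (nt_id L) (nt_id L) (s k.+1) (res_d P k.+1)) //.
rewrite (@tensor_map_comp _ _ _ _ _ _ _ (nt_id L) (nt_id L) (res_d P k) (s k)) //.
by rewrite [X in _ = _ + tensor_map _ _ X]gv raddf0 addr0.
Qed.
End Comparison.

(** * Finitely generated projective modules *)

(* Both Tor_lim and Tor_prod are induced by the legs of a limit cone of
   comodules: U is the type of transition maps, empty in the case of products. *)
Section Cone.
Variables (J : Type) (U : J -> J -> Type).

(** Together with [jointly_surj], this describes injectivity and surjectivity of the map from [V] to
    the limit of the [W j] without forming that limit. *)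
Definition jointly_inj (V : zmodType) (W : J -> zmodType)
    (q : forall j, {additive V -> W j}) : Prop :=
  forall v, (forall j, q j v = 0) -> v = 0.

Definition jointly_surj (V : zmodType) (W : J -> zmodType)
    (w : forall i j, U i j -> {additive W i -> W j})
    (q : forall j, {additive V -> W j}) : Prop :=
  forall c : forall j, W j, (forall i j (u : U i j), w i j u (c i) = c j) ->
  exists v, forall j, q j v = c j.

Record cone (C : category) := Cone {
  apex : functor C;
  leg : J -> functor C;
  trans : forall i j, U i j -> nattrans (leg i) (leg j);
  leg_proj : forall j, nattrans apex (leg j) }.

Variables (C : category).
Implicit Types (c : cone C).

Definition is_limit c : Prop :=
  [/\ forall i j (u : U i j) x l, trans c u x (leg_proj c i x l) = leg_proj c j x l,
      forall x, jointly_inj (fun j => leg_proj c j x) &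
      forall x, jointly_surj (fun i j u => trans c u x) (fun j => leg_proj c j x)].

Definition tensor_inj c (M : functor (opcat C)) : Prop :=
  jointly_inj (fun j => tensor_map (leg_proj c j) (nt_id M)).

Definition tensor_surj c (M : functor (opcat C)) : Prop :=
  jointly_surj (fun i j u => tensor_map (trans c u) (nt_id M))
    (fun j => tensor_map (leg_proj c j) (nt_id M)).

Variables (A : functor (opcat C)).
Implicit Types P Q : resolution A.

Definition Tor_inj c P k : Prop := jointly_inj (fun j => Tor_map P (leg_proj c j) k).

Definition Tor_surj c P k : Prop :=
  jointly_surj (fun i j u => Tor_map P (trans c u) k)
    (fun j => Tor_map P (leg_proj c j) k).

(** The comparison isomorphism is natural in the comodule, so it commutes with the legs of the
    cone. *)
Lemma Tor_inj_compare c P Q k : Tor_inj c P k -> Tor_inj c Q k.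
Proof.
move=> iP t t0; rewrite -(@compareK _ _ Q P _ _ t); set t' := compare Q P _ _ t.
rewrite (iP t') ?raddf0 // => j.
by rewrite /t' -compare_natural t0 raddf0.
Qed.

Lemma Tor_surj_compare c P Q k : Tor_surj c P k -> Tor_surj c Q k.
Proof.
move=> sP e eE; have [i j u|t tE] := sP (fun j => compare Q P _ _ (e j)).
  by rewrite -compare_natural eE.
by exists (compare P Q _ _ t) => j; rewrite -compare_natural tE compareK.
Qed.
End Cone.

(** * Free modules on orbits, Yoneda maps and dual bases *)

Section FreeModules.
Variables (G : group) (X : subgroup_family G).
Local Notation C := (orbit_cat X).
Implicit Types (D E : orbit X) (M : module X) (L : comodule X).

(** The component at [E] of the Yoneda map from Z[-, D] to [M] that sends the identity to [b];
    [coev] is its covariant counterpart, from Z[E, -] to [L]. *)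
Definition ev M D (b : M D) E : {additive Zmaps E D -> M E} :=
  freeg_lift (fun f : {classic gmap E D} => fmap M (f : @mor (opcat C) D E) b).

Lemma evU M D (b : M D) E (f : gmap E D) :
  ev b E << (f : {classic gmap E D}) >> = fmap M (f : @mor (opcat C) D E) b.
Proof. exact: freeg_liftU. Qed.

Definition coev L E (l : L E) D : {additive Zmaps E D -> L D} :=
  freeg_lift (fun f : {classic gmap E D} => fmap L (f : @mor C E D) l).

Lemma coevU L E (l : L E) D (f : gmap E D) :
  coev l D << (f : {classic gmap E D}) >> = fmap L (f : @mor C E D) l.
Proof. exact: freeg_liftU. Qed.

Lemma ev_pre M D (b : M D) E E' (f : gmap E' E) w :
  ev b E' (Zpre D f w) = fmap M (f : @mor (opcat C) E E') (ev b E w).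
Proof.
move: w; apply: (@freeg_ext _ _ (ev b E' \o Zpre D f)
  (fmap M (f : @mor (opcat C) E E') \o ev b E)) => u.
rewrite [LHS](congr1 (ev b E') (freeg_mapU _ _)) [LHS]evU.
by rewrite [RHS](congr1 (fmap M _) (evU b u)) -fmap_comp.
Qed.

Lemma ev_nat M M' (a : nattrans M M') D (b : M D) E w :
  a E (ev b E w) = ev (a D b) E w.
Proof.
move: w; apply: (@freeg_ext _ _ (a E \o ev b E) (ev (a D b) E)) => u.
by rewrite [LHS](congr1 (a E) (evU b u)) evU naturality.
Qed.

Lemma coev_nat L L' (a : nattrans L L') E (l : L E) D w :
  a D (coev l D w) = coev (a E l) D w.
Proof.
move: w; apply: (@freeg_ext _ _ (a D \o coev l D) (coev (a E l) D)) => u.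
by rewrite [LHS](congr1 (a D) (coevU l u)) coevU naturality.
Qed.

Lemma coev_pre L E E' (f : gmap E' E) (l : L E') D w :
  coev (fmap L (f : @mor C E' E) l) D w = coev l D (Zpre D f w).
Proof.
move: w; apply: (@freeg_ext _ _ (coev _ D) (coev l D \o Zpre D f)) => u.
rewrite [RHS](congr1 (coev l D) (freeg_mapU _ _)) [RHS]coevU.
by rewrite [LHS]coevU -fmap_comp.
Qed.

Lemma coevD L E (l l' : L E) D w : coev (l + l') D w = coev l D w + coev l' D w.
Proof.
move: w; apply: (@freeg_ext _ _ (coev _ D) (coev l D \+ coev l' D)) => u.
by rewrite [LHS]coevU raddfD -!coevU.
Qed.

(** The balancing relation of the tensor product, extended linearly from a single G-map to a formal
    sum [w] of G-maps. *)
Lemma pure_coev L M E D (l : L E) (b : M D) w :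
  pure (coev l D w) b = pure l (ev b E w).
Proof.
move: w; apply: (@freeg_ext _ _ (purel L b \o coev l D) (purer M l \o ev b E)) => u.
rewrite [LHS](congr1 (purel L b) (coevU l u)).
rewrite [RHS](congr1 (purer M l) (evU b u)); exact: pure_balanced.
Qed.

Section Sum.
Variables (m : nat) (D : 'I_m -> orbit X).

(** A finite direct sum, encoded as the product, which is the same over ['I_m]. *)
Definition free_sum : module X := prodF (fun j => free_module X (D j)).

Definition sum_lift_fun M (b : forall j, M (D j)) E (w : free_sum E) : M E :=
  \sum_j ev (b j) E (w j).

Lemma sum_lift_funB M (b : forall j, M (D j)) E :
  {morph @sum_lift_fun M b E : v w / v - w}.
Proof.
by move=> v w; rewrite -sumrB; apply: eq_bigr => j _; rewrite -raddfB.
Qed.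

Definition sum_lift M (b : forall j, M (D j)) : nattrans free_sum M.
Proof.
exists (fun E => additive_of (@sum_lift_funB M b E)) => E E' f w.
rewrite -[LHS]/(\sum_j ev (b j) E' (Zpre (D j) f (w j))) [RHS]raddf_sum.
by apply: eq_bigr => j _; apply: ev_pre.
Defined.

Lemma sum_liftE M (b : forall j, M (D j)) E w :
  sum_lift b E w = \sum_j ev (b j) E (w j).
Proof. by []. Qed.

Lemma sum_lift_nat M M' (a : nattrans M M') (b : forall j, M (D j)) E w :
  a E (sum_lift b E w) = sum_lift (fun j => a (D j) (b j)) E w.
Proof. by rewrite !sum_liftE raddf_sum; apply: eq_bigr => j _; apply: ev_nat. Qed.

(** The inclusion of the summand [j]; the cast is needed because the type of an entry depends on its
    index. *)
Definition sum_single E (j : 'I_m) (v : Zmaps E (D j)) : free_sum E :=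
  fun i => if @eqP _ j i is ReflectT ji
           then ecast i (Zmaps E (D i)) ji v else 0.

Lemma sum_single_id E (j : 'I_m) (v : Zmaps E (D j)) : sum_single v j = v.
Proof. by rewrite /sum_single; case: eqP => // e; rewrite eq_axiomK. Qed.

Lemma sum_single_neq E (i j : 'I_m) (v : Zmaps E (D j)) :
  i != j -> sum_single v i = 0.
Proof.
by move=> /eqP ij; rewrite /sum_single; case: eqP => // ji; case: ij.
Qed.

Lemma sum_lift_single M (b : forall j, M (D j)) E j (v : Zmaps E (D j)) :
  sum_lift b E (sum_single v) = ev (b j) E v.
Proof.
rewrite sum_liftE (bigD1 j) // sum_single_id big1 => [|i /andP[_ ij]]; first exact: addr0.
by rewrite sum_single_neq //; exact: raddf0.
Qed.

Definition sum_gen j : free_sum (D j) :=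
  sum_single << (gmap_id (D j) : {classic gmap (D j) (D j)}) >>.

Lemma sum_gen_lift E w : sum_lift sum_gen E w = w.
Proof.
apply: functional_extensionality_dep => i.
rewrite sum_liftE -[LHS]/(dproj i (\sum_j ev (sum_gen j) E (w j))) raddf_sum.
rewrite (bigD1 i) // big1 => [|j /andP[_ ji]].
  rewrite [LHS]addr0; move: (w i).
  apply: (@freeg_ext _ _ (dproj i \o ev (sum_gen i) E) idfun) => u.
  rewrite [LHS](congr1 (dproj i) (evU (sum_gen i) u)).
  rewrite -[LHS]/(Zpre _ _ (sum_gen i i)) /sum_gen sum_single_id.
  by rewrite [LHS]freeg_mapU; congr << _ >>; apply: gmap_ext.
move: (w j); apply: (@freeg_ext _ _ (dproj i \o ev (sum_gen j) E) \0) => u.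
rewrite [LHS](congr1 (dproj i) (evU (sum_gen j) u)).
rewrite -[LHS]/(Zpre _ _ (sum_gen j i)) /sum_gen.
by rewrite sum_single_neq 1?eq_sym //; exact: raddf0.
Qed.

(** By Yoneda a map out of the sum is determined by the images of the generators, and these are
    lifted one by one. *)
Lemma free_sum_projective : projective free_sum.
Proof.
move=> F F' p f ps.
exists (sum_lift (fun j => sval (cid (ps _ (f (D j) (sum_gen j)))))) => E w.
rewrite sum_lift_nat -[in RHS](sum_gen_lift w) sum_lift_nat !sum_liftE.
by apply: eq_bigr => j _; case: cid => /= v ->.
Qed.
End Sum.

(** Finite generation by a list of elements at orbits; its agreement with [finitely_generated] is
    proved below. *)
Definition fgen M : Prop :=
  exists (m : nat) (D : 'I_m -> orbit X) (b : forall j, M (D j)),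
    forall E, surjective (sum_lift b E).

Lemma free_sum_fgen (m : nat) (D : 'I_m -> orbit X) : fgen (free_sum D).
Proof. by exists m, D, (@sum_gen m D) => E w; exists w; apply: sum_gen_lift. Qed.

(* A finitely generated projective module M is a retract of a free_sum: the
   section s gives coordinate maps dual to the generators b, hence
   l (x) a = \sum_j L(s_j a)(l) (x) b_j in every tensor product with M. *)
Section DualBasis.
Variables (M : module X) (m : nat) (D : 'I_m -> orbit X) (b : forall j, M (D j)).
Variables (s : nattrans M (free_sum D)).
Hypothesis sK : forall E a, sum_lift b E (s E a) = a.

Section Coordinates.
Variable L : comodule X.

Definition coord (j : 'I_m) : {additive tensor L M -> L (D j)}.
Proof.
refine (@tensor_lift C L M (L (D j)) (fun E l a => coev l (D j) (s E a j)) _ _ _).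
- by move=> E l l' a; apply: coevD.
- move=> E l a a'; rewrite -[RHS]raddfD; congr (coev _ _ _).
  exact: (congr1 (dproj j) (raddfD (s E) a a')).
- by move=> E E' f l a; rewrite coev_pre naturality.
Defined.

Lemma coord_pure j E (l : L E) (a : M E) : coord j (pure l a) = coev l (D j) (s E a j).
Proof. exact: tensor_lift_pure. Qed.

Lemma coord_expansion t : t = \sum_j pure (coord j t) (b j).
Proof.
have SB : {morph (fun t => \sum_j pure (coord j t) (b j)) : t t' / t - t'}.
  move=> u v; rewrite -sumrB; apply: eq_bigr => j _.
  by rewrite raddfB -[LHS]/(purel L (b j) _) raddfB.
move: t; apply: (@tensor_ext _ _ _ _ idfun (additive_of SB)) => E l a.
rewrite -[LHS]/(pure l a) -[RHS]/(\sum_j pure (coord j (pure l a)) (b j)).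
rewrite -[in LHS](sK a) sum_liftE -[LHS]/(purer M l _) raddf_sum.
by apply: eq_bigr => j _; rewrite coord_pure pure_coev.
Qed.
End Coordinates.

Lemma coord_nat L L' (a : nattrans L L') j t :
  coord L' j (tensor_map a (nt_id M) t) = a (D j) (coord L j t).
Proof.
move: t; apply: (@tensor_ext _ _ _ _ (coord L' j \o tensor_map a (nt_id M))
  (a (D j) \o coord L j)) => E l x.
rewrite -[LHS]/(coord L' j (tensor_map a (nt_id M) (pure l x))).
rewrite -[RHS]/(a (D j) (coord L j (pure l x))).
by rewrite tensor_map_pure !coord_pure coev_nat.
Qed.
End DualBasis.

(** By the dual basis an element is determined by its finitely many coordinates in the groups
    [L (D j)], where [L] is a comodule of the cone and the limit is taken pointwise. *)
Lemma fgen_projective_tensor M (J : Type) (U : J -> J -> Type) (c : cone U C) :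
  fgen M -> projective M -> is_limit c -> tensor_inj c M /\ tensor_surj c M.
Proof.
move=> [m [D [b bs]]] pM [_ ci cs].
(* Projectivity splits the cover by generators, which gives the dual basis. *)
have [s sK] := pM _ _ (sum_lift b) (nt_id M) bs.
split=> [t t0|t tE].
  rewrite [LHS](coord_expansion sK) big1 // => j _.
  have -> : coord s (apex c) j t = 0.
    by apply: ci => i; rewrite -coord_nat t0 raddf0.
  by rewrite -[LHS]/(purel _ _ _) raddf0.
have [l lE] : exists l : forall j, apex c (D j),
    forall i j, leg_proj c i (D j) (l j) = coord s (leg c i) j (t i).
  have lex j : exists l, forall i, leg_proj c i (D j) l = coord s (leg c i) j (t i).
    by apply: cs => i i' u; rewrite -coord_nat (tE _ _ u).
  by exists (fun j => sval (cid (lex j))) => i j; case: cid.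
exists (\sum_j pure (l j) (b j)) => i; rewrite raddf_sum [RHS](coord_expansion sK).
by apply: eq_bigr => j _; rewrite tensor_map_pure lE.
Qed.
End FreeModules.

(** * Finite generation and orbits *)

Section FinitelyGenerated.
Variables (G : group) (X : subgroup_family G).
Local Notation C := (orbit_cat X).
Implicit Types (M : module X).

(** * Orbits of a G-set with stabilisers in the family *)

Section OrbitOf.
Variables (D : gset G) (XD : stabilisers_in X D) (r : D).

Definition orbit_carrier : Type := {y : D | exists g, act g r = y}.

Lemma orbit_carrier_ext (y z : orbit_carrier) : sval y = sval z -> y = z.
Proof.
case: y z => [y Hy] [z Hz] /= yz; case: z / yz Hz => Hz.
by congr exist; apply: Prop_irrelevance.
Qed.

Lemma orbit_act_subproof g (y : orbit_carrier) : exists h, act h r = act g (sval y).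
Proof. by have [h <-] := svalP y; exists (gmul g h); rewrite actM. Qed.

Definition orbit_act g (y : orbit_carrier) : orbit_carrier :=
  exist _ (act g (sval y)) (orbit_act_subproof g y).

Lemma orbit_act1 y : orbit_act gone y = y.
Proof. by apply: orbit_carrier_ext; rewrite /= act1. Qed.

Lemma orbit_actM g h y : orbit_act (gmul g h) y = orbit_act g (orbit_act h y).
Proof. by apply: orbit_carrier_ext; rewrite /= actM. Qed.

Definition orbit_gset_of : gset G := GSet orbit_act1 orbit_actM.

Lemma orbit_gset_of_transitive : transitive_gset orbit_gset_of.
Proof.
split=> [|[y [g gy]] [z [h hz]]]; first by constructor; exists r, gone; rewrite act1.
exists (gmul h (ginv g)); apply: orbit_carrier_ext.
by rewrite /= -gy -actM -gmulA gmulV gmulr1.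
Qed.

Lemma orbit_gset_of_stabilisers : stabilisers_in X orbit_gset_of.
Proof.
move=> y; suff -> : stabiliser y = stabiliser (sval y) by exact: XD.
apply: functional_extensionality_dep => g; apply: propext.
by split=> [/(congr1 sval)|gy]; last exact: orbit_carrier_ext.
Qed.

Definition orbit_of : orbit X := Orbit orbit_gset_of_transitive orbit_gset_of_stabilisers.

Definition orbit_incl : gmap orbit_of D := @GMap G orbit_of D sval (fun _ _ => erefl).

(** As [E] is transitive, the image of [u] is the single orbit of [u e]. *)
Lemma orbit_of_factor (E : orbit X) (u : gmap E D) e g :
  act g r = u e -> exists f : gmap E orbit_of, u = gmap_comp orbit_incl f.
Proof.
move=> gr; have im x : exists h, act h r = u x.
  have [h <-] := (orbit_transitive E).2 e x.
  by exists (gmul h g); rewrite actM gr gfun_act.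
have fP h x : exist _ (u (act h x)) (im (act h x)) =
    act h (exist _ (u x) (im x) : orbit_of).
  by apply: orbit_carrier_ext; rewrite /= gfun_act.
by exists (@GMap G E orbit_of (fun x => exist _ (u x) (im x)) fP); apply: gmap_ext.
Qed.
End OrbitOf.

(** Each orbit representative contributes one generator, the image under [p] of the inclusion of its
    orbit. These suffice because every G-map from a transitive set factors through one orbit. *)
Lemma finitely_generated_fgen M : finitely_generated M -> fgen M.
Proof.
move=> [D [XD [m [r rP]] [p ps]]].
pose u i : {classic gmap (orbit_of XD (r i)) D} := orbit_incl XD (r i).
pose b i : M (orbit_of XD (r i)) := p (orbit_of XD (r i)) << u i >>.
exists m, (fun i => orbit_of XD (r i)), b => E.
have v (f : {classic gmap E D}) : {v | sum_lift b E v = p E << f >>}.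
  apply: cid; case: (orbit_transitive E) => [[e] _].
  have [i [g gr]] := rP ((f : gmap E D) e).
  have [f' fE] := orbit_of_factor XD gr.
  exists (sum_single (D := fun i => orbit_of XD (r i))
            (<< (f' : {classic gmap E (orbit_of XD (r i))}) >>)).
  rewrite sum_lift_single evU /b -naturality; congr (p E _).
  by rewrite [LHS]freeg_mapU; congr << _ >>; rewrite [RHS]fE.
move=> a; have [w <-] := ps E a.
exists (freeg_lift (V := free_sum _ E) (fun f => sval (v f)) w).
move: w; apply: (@freeg_ext _ _ (sum_lift b E \o freeg_lift _) (p E)) => f.
by rewrite [LHS](congr1 (sum_lift b E) (freeg_liftU _ f)); case: (v f).
Qed.

(** Rests on uniqueness of equality proofs in [I], whose equality is decidable. *)
Lemma Tagged_inj (I : eqType) (T : I -> Type) (i : I) (x y : T i) :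
  Tagged T x = Tagged T y -> x = y.
Proof.
have H u (xu : Tagged T x = u) (p : tag u = i) : x = etagged p.
  by case: u / xu p => /= p; rewrite /etagged eq_axiomK.
by move=> /H /(_ erefl).
Qed.

(** * Finite disjoint unions of orbits *)

Section DisjointUnion.
Variables (m : nat) (D : 'I_m -> orbit X).

(* This is {i & D i}, except that ordinals live in a universe too large for the
   carrier of a G-set. *)
Inductive union_carrier : Type :=
  UnionElt (k : nat) (lt_km : (k < m)%N) (y : D (Ordinal lt_km)).

Definition union_tagged (y : union_carrier) : {i & D i} :=
  match y with UnionElt _ _ y => Tagged D y end.

Definition union_elt (i : 'I_m) : D i -> union_carrier :=
  match i return D i -> union_carrier with Ordinal k lt_km => fun y => UnionElt y end.

Lemma union_tagged_elt i (y : D i) : union_tagged (union_elt y) = Tagged D y.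
Proof. by case: i y. Qed.

Lemma union_eltK y : union_elt (tagged (union_tagged y)) = y.
Proof. by case: y. Qed.

Definition union_act g (y : union_carrier) : union_carrier :=
  match y with UnionElt _ _ y => UnionElt (act g y) end.

Lemma union_act1 y : union_act gone y = y.
Proof. by case: y => k lt y /=; rewrite act1. Qed.

Lemma union_actM g h y : union_act (gmul g h) y = union_act g (union_act h y).
Proof. by case: y => k lt y /=; rewrite actM. Qed.

Definition union_gset : gset G := GSet union_act1 union_actM.

Lemma union_tagged_act g (y : union_gset) :
  union_tagged (act g y) = Tagged D (act g (tagged (union_tagged y))).
Proof. by case: y. Qed.

Lemma union_act_elt g i (y : D i) :
  act g (union_elt y : union_gset) = union_elt (act g y).
Proof. by case: i y. Qed.

Lemma union_gset_stabilisers : stabilisers_in X union_gset.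
Proof.
move=> y; suff -> : stabiliser y = stabiliser (tagged (union_tagged y)).
  exact: orbit_stabilisers.
apply: functional_extensionality_dep => g; apply: propext; rewrite /stabiliser; split=> E.
  by apply: (Tagged_inj (T := D)); rewrite -union_tagged_act E; case: (union_tagged y).
by rewrite -[in LHS](union_eltK y) union_act_elt E union_eltK.
Qed.

Lemma union_gset_finite : finitely_many_orbits union_gset.
Proof.
have r i : {y : D i | True}.
  by apply: cid; case: (orbit_transitive (D i)) => [[y] _]; exists y.
exists m, (fun i => union_elt (sval (r i))) => y; exists (tag (union_tagged y)).
have [g gy] := (orbit_transitive _).2 (sval (r _)) (tagged (union_tagged y)).
by exists g; rewrite union_act_elt gy union_eltK.
Qed.

Definition union_incl i : gmap (D i) union_gset :=
  @GMap G (D i) union_gset (@union_elt i) (fun g y => esym (union_act_elt g y)).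

(** The action preserves the summand, so on a transitive [E] all values of [u] lie in the summand of
    one chosen value. *)
Lemma union_factor (E : orbit X) (u : gmap E union_gset) :
  exists i (f : gmap E (D i)), u = gmap_comp (union_incl i) f.
Proof.
case: (orbit_transitive E) => [[e] tr].
exists (tag (union_tagged (u e))).
have tE x : tag (union_tagged (u x)) = tag (union_tagged (u e)).
  by have [g <-] := tr e x; rewrite gfun_act union_tagged_act.
have fP g x : etagged (tE (act g x)) = act g (etagged (tE x)).
  apply: (Tagged_inj (T := D)); rewrite etaggedK gfun_act union_tagged_act.
  by rewrite -[in LHS](etaggedK (tE x)).
exists (@GMap G E (D (tag (union_tagged (u e)))) (fun x => etagged (tE x)) fP).
apply: gmap_ext => x.
by rewrite -[LHS]union_eltK -[in LHS](etaggedK (tE x)).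
Qed.

Variables (M : module X) (b : forall i, M (D i)).

(** A transitive [E] has a point, and its image determines the summand; the two factorisations then
    coincide. *)
Lemma union_value_unique (E : orbit X) i j (f : gmap E (D i)) (f' : gmap E (D j)) :
  gmap_comp (union_incl i) f = gmap_comp (union_incl j) f' ->
  fmap M (f : @mor (opcat C) (D i) E) (b i) = fmap M (f' : @mor (opcat C) (D j) E) (b j).
Proof.
move=> ff'; have {}ff' e := congr1 (fun u : gmap E union_gset => u e) ff'.
case: (orbit_transitive E) => [[e] _].
have {}ff' x : Tagged D (f x) = Tagged D (f' x).
  by have := congr1 union_tagged (ff' x); rewrite !union_tagged_elt.
have /= ij := congr1 tag (ff' e); case: j / ij f' ff' => f' ff'.
by congr (fmap M _ _); apply: gmap_ext => x; apply: Tagged_inj (ff' x).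
Qed.

(** The value is characterised through all factorisations of [u], so that it can be computed from
    whichever one is at hand. *)
Lemma union_value (E : orbit X) (u : {classic gmap E union_gset}) :
  {a : M E | forall i (f : gmap E (D i)), (u : gmap _ _) = gmap_comp (union_incl i) f ->
    a = fmap M (f : @mor (opcat C) (D i) E) (b i)}.
Proof.
apply: cid; have [i [f uE]] := union_factor u.
exists (fmap M (f : @mor (opcat C) (D i) E) (b i)) => j f' u'E.
by apply: union_value_unique; rewrite -uE.
Qed.

Definition union_lift : nattrans (free_module X union_gset) M.
Proof.
refine (@NatTrans (opcat C) (free_module X union_gset) M
  (fun E => freeg_lift (fun u : {classic gmap E union_gset} => sval (union_value u))) _).
move=> E E' h; apply: (@freeg_ext _ _ (freeg_lift _ \o Zpre union_gset h)
  (fmap M h \o freeg_lift _)) => u.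
rewrite [LHS](congr1 (freeg_lift _) (freeg_mapU _ _)) freeg_liftU.
rewrite [RHS](congr1 (fmap M h) (freeg_liftU _ _)).
have [i [f uE]] := union_factor u.
rewrite (svalP (union_value u) i f uE) -fmap_comp.
by apply: (svalP (union_value _) i (gmap_comp f h)); rewrite uE; apply: gmap_ext.
Defined.

Lemma union_lift_incl (E : orbit X) i (w : Zmaps E (D i)) :
  union_lift E (Zpost E (union_incl i) w) = ev (b i) E w.
Proof.
move: w; apply: (@freeg_ext _ _ (union_lift E \o Zpost E (union_incl i))
  (ev (b i) E)) => f.
rewrite [LHS](congr1 (union_lift E) (freeg_mapU _ _)) [LHS]freeg_liftU evU.
exact: (svalP (union_value _)).
Qed.

Lemma union_lift_surj :
  (forall E, surjective (sum_lift b E)) -> forall E, surjective (union_lift E).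
Proof.
move=> bs E a; have [w <-] := bs E a.
exists (\sum_i Zpost E (union_incl i) (w i)).
rewrite sum_liftE raddf_sum; apply: eq_bigr => i _; exact: union_lift_incl.
Qed.
End DisjointUnion.

Lemma fgen_finitely_generated M : fgen M -> finitely_generated M.
Proof.
move=> [m [D [b bs]]]; exists (union_gset D); split.
- exact: union_gset_stabilisers.
- exact: union_gset_finite.
- by exists (union_lift b); apply: union_lift_surj.
Qed.

(** * Orbits as coset spaces *)

Lemma act_eq_shift (D : gset G) g (x y : D) : act (ginv g) x = y <-> x = act g y.
Proof. by split=> [<-|->]; rewrite -actM ?gmulVr ?gmulV act1. Qed.

(** With [K] the stabiliser of a point [e], the maps are gK |-> ge and x |-> {g | ge = x}. *)
Lemma orbit_retract_coset (E : orbit X) :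
  exists (K : {K | X K}) (f : gmap (coset_orbit K) E) (h : gmap E (coset_orbit K)),
    forall x, f (h x) = x.
Proof.
case: (orbit_transitive E) => [[e] tr].
pose K : {K | X K} := exist _ (stabiliser e) (orbit_stabilisers e).
have lcosetE g g' : lcoset (sval K) g g' <-> act g' e = act g e.
  by rewrite /lcoset /= /stabiliser actM act_eq_shift.
have repP (a : coset (sval K)) : exists x : E, forall g, sval a g <-> act g e = x.
  by have [g ->] := svalP a; exists (act g e).
have hP x : exists g, (fun g => act g e = x) = lcoset (sval K) g.
  have [g <-] := tr e x; exists g; apply: functional_extensionality_dep => g'.
  by apply: propext; rewrite lcosetE.
have fP g (a : coset_orbit K) : sval (cid (repP (act g a))) = act g (sval (cid (repP a))).
  case: cid => x xP; case: cid => y yP /=.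
  have [g' g'x] := tr e x.
  have /xP : act g' e = x by [].
  by move=> /yP; rewrite actM act_eq_shift => <-.
have hA g x : exist _ _ (hP (act g x)) = act g (exist _ _ (hP x) : coset_orbit K).
  by apply: coset_ext => g'; rewrite /= actM act_eq_shift.
exists K, (@GMap G (coset_orbit K) E (fun a => sval (cid (repP a))) fP).
exists (@GMap G E (coset_orbit K) (fun x => exist _ _ (hP x)) hA) => x /=.
by case: cid => y yP /=; have [g gx] := tr e x; rewrite -gx; apply/esym/yP.
Qed.

(** An element at [E] is moved to G/K along the retraction, lifted there, and the lift is moved
    back. Generation can thus be tested at the objects that occur in the free products. *)
Lemma surj_on_cosets M (m : nat) (D : 'I_m -> orbit X) (b : forall j, M (D j)) :
  (forall K, surjective (sum_lift b (coset_orbit K))) ->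
  forall E, surjective (sum_lift b E).
Proof.
move=> bs E a; have [K [f [h fh]]] := orbit_retract_coset E.
have [w wE] := bs K (fmap M (f : @mor (opcat C) E (coset_orbit K)) a).
exists (fmap (free_sum D) (h : @mor (opcat C) (coset_orbit K) E) w).
rewrite naturality wE -fmap_comp -[RHS]fmap_id.
by congr (fmap M _ _); apply: gmap_ext.
Qed.
End FinitelyGenerated.

(** * Exact limits of abelian groups *)

Section Image.
Variables (V W : zmodType) (g : {additive V -> W}).

Definition image_pred : {pred W} := fun w => `[< exists v, g v = w >].

Lemma image_closed : zmod_closed image_pred.
Proof.
split=> [|w w' /asboolP [v <-] /asboolP [v' <-]]; apply/asboolP.
  by exists 0; rewrite raddf0.
by exists (v - v'); rewrite raddfB.
Qed.
HB.instance Definition _ := GRing.isZmodClosed.Build W image_pred image_closed.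

Lemma image_in v : g v \in image_pred. Proof. by apply/asboolP; exists v. Qed.

Definition to_image v : subgrp image_pred := Sub (g v) (image_in v).

Lemma val_to_image v : val (to_image v) = g v. Proof. exact: SubK. Qed.

Lemma val_imageB (z z' : subgrp image_pred) : val (z - z') = val z - val z'.
Proof. exact: raddfB. Qed.

Lemma to_imageB : {morph to_image : x y / x - y}.
Proof. by move=> x y; apply: val_inj; rewrite val_imageB !val_to_image raddfB. Qed.

Lemma to_image_surj : surjective to_image.
Proof.
move=> z; have /asboolP [v vE] := valP z.
by exists v; apply: val_inj; rewrite val_to_image.
Qed.
End Image.

Section ImageFunctor.
Variables (C : category) (F F' : functor C) (g : nattrans F F').

Lemma imF_subproof x y (f : mor x y) (z : subgrp (image_pred (g x))) :
  fmap F' f (val z) \in image_pred (g y).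
Proof.
have /asboolP [v <-] := valP z.
by apply/asboolP; exists (fmap F f v); rewrite naturality.
Qed.

Definition imF_map x y (f : mor x y) (z : subgrp (image_pred (g x))) : subgrp (image_pred (g y)) :=
  Sub (fmap F' f (val z)) (imF_subproof f z).

Lemma val_imF_map x y (f : mor x y) z : val (imF_map f z) = fmap F' f (val z).
Proof. exact: SubK. Qed.

Lemma imF_mapB x y (f : mor x y) : {morph imF_map f : z z' / z - z'}.
Proof.
by move=> z z'; apply: val_inj; rewrite val_imageB !val_imF_map val_imageB raddfB.
Qed.

Definition imF : functor C.
Proof.
refine (@Functor C (fun x => subgrp (image_pred (g x)))
  (fun x y f => additive_of (@imF_mapB x y f)) _ _).
- by move=> x z; apply: val_inj; rewrite [LHS]val_imF_map fmap_id.
- move=> x y t h f z; apply: val_inj; rewrite [LHS]val_imF_map [RHS]val_imF_map.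
  by rewrite [X in _ = fmap _ _ X]val_imF_map fmap_comp.
Defined.

Definition imF_cover : nattrans F imF.
Proof.
refine (@NatTrans C F imF (fun x => additive_of (@to_imageB _ _ (g x))) _).
move=> x y f a; apply: val_inj; rewrite [LHS]val_to_image [RHS]val_imF_map.
by rewrite [X in _ = fmap _ _ X]val_to_image naturality.
Defined.
End ImageFunctor.

Section ConstantDiagram.
Variables (I C : category).

Definition constF (V : zmodType) : functor C :=
  @Functor C (fun=> V) (fun _ _ _ => idfun) (fun _ _ => erefl) (fun _ _ _ _ _ _ => erefl).

Definition constF_map (V W : zmodType) (f : {additive V -> W}) :
    nattrans (constF V) (constF W) :=
  @NatTrans C (constF V) (constF W) (fun=> f) (fun _ _ _ _ => erefl).

Definition const_diagram (D : functor I) : diagram I C :=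
  @Diagram I C (fun i => constF (D i)) (fun i j u => constF_map (fmap D u))
    (fun i _ a => @fmap_id I D i a) (fun i j k v u _ a => @fmap_comp I D i j k v u a).

Definition const_diagram_map (D D' : functor I) (g : nattrans D D') :
    diagram_map (const_diagram D) (const_diagram D') :=
  @DiagramMap I C (const_diagram D) (const_diagram D')
    (fun i => constF_map (g i)) (fun i j u _ a => @naturality I D D' g i j u a).
End ConstantDiagram.

(** The form in which exactness of limits is used: [lim] preserves surjectivity of the map from [D]
    onto the image of [g]. *)
Definition lifts_compatible (I : category) : Prop :=
  forall (D D' : functor I) (g : nattrans D D') (c : forall i, D' i),
    (forall i j (u : mor i j), fmap D' u (c i) = c j) ->
    (forall i, exists a, g i a = c i) ->
  exists a : forall i, D i,
    (forall i j (u : mor i j), fmap D u (a i) = a j) /\ (forall i, g i (a i) = c i).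

(* Limits of diagrams of abelian groups are limits of constant functors, which
   can be evaluated as soon as C has an object. *)
Lemma exact_limits_lift (I C : category) (x : C) :
  exact_limits I C -> lifts_compatible I.
Proof.
move=> exI D D' g c cc cim.
(* Replacing [g] by the map onto its image yields a short exact sequence with [kerF p]. *)
pose p := imF_cover g.
have ses i y : short_exact (const_diagram_map C (kerF_val p) i y)
    (const_diagram_map C p i y).
  split=> [a b ab|v|]; [exact: val_inj| |exact: to_image_surj].
  by split=> [pv|[z <-]]; [exists (ker_elt pv); exact: val_ker_elt | exact: kerE].
have [_ _ surj] := exI _ _ _ _ _ ses x.
pose F := eval (const_diagram C (imF g)) x.
have ci i : c i \in image_pred (g i) by apply/asboolP.
pose ce i : subgrp (image_pred (g i)) := Sub (c i) (ci i).
have ceE i : val (ce i) = c i by exact: SubK.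
have cc' : (ce : dprod F) \in @compatible I F.
  by apply/asboolP => i j u; apply: val_inj; rewrite [LHS]val_imF_map !ceE.
have [a aE] := surj (Sub (ce : dprod F) cc' : lim F).
exists (fun i => lim_proj i a); split=> [i j u|i]; first exact: (lim_projP u a).
rewrite -ceE -[LHS]val_to_image.
by rewrite -[LHS]/(val (lim_proj i (limF_map (const_diagram_map C p) x a))) aE.
Qed.

Lemma lim_of_compatible (I : category) (D : functor I) (c : forall i, D i) :
  (forall i j (u : mor i j), fmap D u (c i) = c j) ->
  exists l : lim D, forall i, lim_proj i l = c i.
Proof.
move=> cc; have cin : (c : dprod D) \in @compatible I D by apply/asboolP.
pose l : lim D := Sub (c : dprod D) cin.
have lE : val l = c by exact: SubK.
by exists l => i; rewrite -[RHS]/((c : dprod D) i) -lE.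
Qed.

(** * Tor and limit cones under exactness *)

Section LimitCone.
Variables (I C : category) (N : diagram I C).

Definition lim_cone : cone (@mor I) C :=
  @Cone _ (@mor I) C (limF N) N (fun i j u => dmap N u) (limF_proj N).

Lemma lim_cone_limit : is_limit lim_cone.
Proof.
split=> [i j u x l|x l l0|x c cc]; first exact: (@lim_projP _ (eval N x) i j u l).
  by apply: lim_ext => i; rewrite raddf0; apply: l0.
exact: (@lim_of_compatible _ (eval N x)).
Qed.

Variables (A : functor (opcat C)) (P : resolution A).
Hypothesis lifts : lifts_compatible I.

Definition tensor_functor (M : functor (opcat C)) : functor I.
Proof.
exists (fun i => tensor (N i) M) (fun i j u => tensor_map (dmap N u) (nt_id M)).
- by move=> i t; apply: tensor_map_id => // x l; apply: dmap_id.
- by move=> i j k v u t; apply: tensor_map_comp => // x l; apply: dmap_comp.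
Defined.

Definition tensor_functor_d k :
    nattrans (tensor_functor (P k)) (tensor_functor (P k.-1)) :=
  @NatTrans I (tensor_functor (P k)) (tensor_functor (P k.-1))
    (fun i => tor_d P (N i) k) (fun i j u t => @tor_chainP _ _ P _ _ (dmap N u) k t).

(** If the components of a cycle are all boundaries, chains bounding them can be chosen compatibly
    and assembled in degree [k.+1]; injectivity in degree [k] shows that the result bounds the
    cycle. *)
Lemma Tor_lim_inj k :
  tensor_inj lim_cone (P k) -> tensor_surj lim_cone (P k.+1) -> Tor_inj lim_cone P k.
Proof.
move=> inj surj h; have [t [dt ->]] := hclassP h => h0.
apply/hclass_eq0.
have [||e [ee eE]] := @lifts _ _ (tensor_functor_d k.+1)
    (fun i => tor_chain P (limF_proj N i) k t).
- move=> i j u; symmetry; apply: tensor_map_comp => // x l; symmetry.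
  exact: (@lim_projP _ (eval N x)).
- move=> i; have := h0 i; rewrite [X in X = _]homology_map_hclass.
  by move=> /hclass_eq0.
have [e' e'E] := surj e ee; exists e'.
apply/eqP; rewrite -subr_eq0; apply/eqP/inj => i.
rewrite raddfB -[X in X - _](@tor_chainP _ _ P _ _ (limF_proj N i) k.+1 e').
by rewrite [tor_chain _ _ _ _]e'E [X in X - _]eE subrr.
Qed.

(** A compatible family of classes is represented by a compatible family of cycles, which assemble
    to a chain. Injectivity one degree lower makes this chain a cycle. *)
Lemma Tor_lim_surj k :
  tensor_inj lim_cone (P k.-1) -> tensor_surj lim_cone (P k) -> Tor_surj lim_cone P k.
Proof.
move=> inj surj c cc.
pose d := tensor_functor_d k.
have clB i : {morph (fun z : subgrp (kernel (d i)) =>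
    quot_pi _ z : Tor P (N i) k) : x y / x - y}.
  by move=> x y; rewrite quot_piB.
have clN i j (u : mor i j) (z : kerF d i) :
    additive_of (clB j) (fmap (kerF d) u z) =
    fmap (Tor_diagram P N k) u (additive_of (clB i) z).
  rewrite [RHS]homology_mapE; congr quot_pi; exact: val_inj.
have [|z [zz zE]] := @lifts _ _ (@NatTrans I (kerF d) (Tor_diagram P N k)
    (fun i => additive_of (clB i)) clN) c cc.
  by move=> i; apply: quot_surj.
have [i j u|t tE] := surj (fun i => val (z i)); first exact: (congr1 val (zz i j u)).
(* For [k = 0] the differential is the zero map and [k.-1] is [0] again. *)
have dt : tor_d P (limF N) k t = 0.
  apply: inj => i; rewrite -[LHS](@tor_chainP _ _ P _ _ (limF_proj N i) k t).
  by rewrite [tor_chain _ _ _ _]tE; apply: kerE.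
exists (hclass _ dt) => i; rewrite [LHS]homology_map_hclass -zE.
by congr quot_pi; apply: val_inj; rewrite val_ker_elt; apply: tE.
Qed.
End LimitCone.

(** * Products as discrete limits *)

Section TorLim.
Variables (I C : category) (N : diagram I C) (A : functor (opcat C)) (P : resolution A).

Lemma additive_injP (V W : zmodType) (f : {additive V -> W}) :
  injective f <-> (forall v, f v = 0 -> v = 0).
Proof.
split=> [fi v fv|f0 v w vw]; first by apply: fi; rewrite fv raddf0.
by apply/eqP; rewrite -subr_eq0; apply/eqP/f0; rewrite raddfB vw subrr.
Qed.

Lemma Tor_lim_injP k : injective (Tor_lim P N k) <-> Tor_inj (lim_cone N) P k.
Proof.
rewrite additive_injP; split=> i t t0; apply: i.
  by apply: lim_ext => j; rewrite raddf0; apply: t0.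
by move=> j; exact: (congr1 (lim_proj j) t0).
Qed.

Lemma Tor_lim_surjP k : surjective (Tor_lim P N k) <-> Tor_surj (lim_cone N) P k.
Proof.
split=> s c; last first.
  have [t tE] := s (fun i => lim_proj i c) (fun i j u => lim_projP u c).
  by exists t; apply: lim_ext => i; apply: tE.
move=> cc; have [y yE] := @lim_of_compatible _ (Tor_diagram P N k) c cc.
have [t tE] := s y; exists t => i.
by rewrite -yE -tE.
Qed.
End TorLim.

Section ProdCone.
Variables (C : category) (J : Type) (L : J -> Type) (F : forall i, L i -> functor C).
Arguments F : clear implicits.

Definition prod_cone : cone (fun _ _ : {i & L i} => False) C :=
  @Cone {i & L i} (fun _ _ => False) C (prodF (fun i => prodF (F i)))
    (fun p => F _ (tagged p)) (fun _ _ u => match u with end)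
    (fun p => nt_comp (prodF_proj (F (tag p)) (tagged p))
                      (prodF_proj (fun i => prodF (F i)) (tag p))).

Lemma prod_cone_limit : is_limit prod_cone.
Proof.
split=> [i j []|x l l0|x c _]; last first.
  by exists (fun i j => c (Tagged L j)); case.
apply: functional_extensionality_dep => i; apply: functional_extensionality_dep => j.
exact: (l0 (Tagged L j)).
Qed.

Variables (A : functor (opcat C)) (P : resolution A).

Lemma Tor_prod_injP k : injective (Tor_prod P F k) <-> Tor_inj prod_cone P k.
Proof.
rewrite additive_injP; split=> i t t0; apply: i.
  apply: functional_extensionality_dep => j; apply: functional_extensionality_dep => l.
  exact: (t0 (Tagged L l)).
by move=> [j l]; exact: (congr1 (fun f => f j l) t0).
Qed.

Lemma Tor_prod_surjP k : surjective (Tor_prod P F k) <-> Tor_surj prod_cone P k.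
Proof.
split=> s c => [_|]; last first.
  have [i j []|t tE] := s (fun p => c (tag p) (tagged p)).
  exists t; apply: functional_extensionality_dep => j.
  by apply: functional_extensionality_dep => l; apply: (tE (Tagged L l)).
have [t tE] := s (fun i j => c (Tagged L j)); exists t => -[j l].
exact: (congr1 (fun f => f j l) tE).
Qed.
End ProdCone.

Section Discrete.
Variables (J : Type).

Definition discrete : category.
Proof.
refine (@Category J (fun x y => x = y) (fun x => erefl)
  (fun x y z g f => etrans f g) _ _ _).
- by move=> x y; case: y /.
- by move=> x y; case: y /.
- by move=> x y z t h g f; case: t / h; case: z / g.
Defined.

Lemma discrete_compatible (D : functor discrete) (c : forall j, D j) i j
  (u : @mor discrete i j) : fmap D u (c i) = c j.
Proof. by case: j / u; apply: (fmap_id (c i)). Qed.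

Lemma discrete_lim (D : functor discrete) (c : forall j, D j) :
  exists l : lim D, forall j, lim_proj j l = c j.
Proof.
by apply: lim_of_compatible; apply: discrete_compatible.
Qed.

Variable C : category.

(** Over a discrete category every family is compatible, so preimages can be chosen independently at
    each index. *)
Lemma exact_limits_discrete : exact_limits discrete C.
Proof.
move=> D1 D2 D3 a b ses x; split=> [v w vw|v|v].
- apply: lim_ext => j; have [inj _ _] := ses j x; apply: inj.
  exact: (congr1 (lim_proj j) vw).
- split=> [bv|[u <-]].
    have pre j : exists u, a j x u = lim_proj j v.
      have [_ ex _] := ses j x; apply/ex.
      exact: (congr1 (lim_proj j) bv).
    have [u uE] := @discrete_lim (eval D1 x) (fun j => sval (cid (pre j))).
    exists u; apply: lim_ext => j.
    by rewrite -[LHS]/(a j x (lim_proj j u)) uE; case: cid.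
  apply: lim_ext => j; have [_ ex _] := ses j x.
  by rewrite raddf0; apply/ex; exists (lim_proj j u).
- have pre j : exists u, b j x u = lim_proj j v by have [_ _ s] := ses j x; apply: s.
  have [u uE] := @discrete_lim (eval D2 x) (fun j => sval (cid (pre j))).
  exists u; apply: lim_ext => j.
  by rewrite -[LHS]/(b j x (lim_proj j u)) uE; case: cid.
Qed.

Variable F : J -> functor C.

Definition discrete_diagram : diagram discrete C.
Proof.
refine (@Diagram discrete C F (fun i j (u : i = j) =>
  match u in _ = j return nattrans (F i) (F j) with erefl => nt_id (F i) end) _ _).
- by [].
- by move=> i j k v u x a; case: k / v.
Defined.
End Discrete.

Section DiscreteProduct.
Variables (C : category) (J : Type) (L : J -> Type) (F : forall i, L i -> functor C).
Arguments F : clear implicits.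
Let N := discrete_diagram (fun p : {i & L i} => F _ (tagged p)).
Let prod := prodF (fun i => prodF (F i)).

(** With [lim_to_prod], identifies the iterated product with the limit over the discrete category of
    pairs of indices. *)
Definition prod_to_lim : nattrans prod (limF N).
Proof.
refine (@NatTrans C prod (limF N) (fun x => @lim_tuple _ (eval N x) (prod x)
  (fun p => leg_proj (prod_cone F) p x)
  (fun i j u l => @discrete_compatible _ (eval N x)
    (fun p => leg_proj (prod_cone F) p x l) i j u)) _).
by move=> x y f a; apply: lim_ext.
Defined.

Definition lim_to_prod : nattrans (limF N) prod.
Proof.
refine (@NatTrans C (limF N) prod (fun x =>
  dtuple (fun i => dtuple (fun j : L i => lim_proj (D := eval N x) (Tagged L j)) :
    {additive _ -> dprod (fun j => F i j x)})) _).
by [].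
Defined.

Variables (A : functor (opcat C)) (P : resolution A).

Lemma Tor_inj_prod_lim k : Tor_inj (lim_cone N) P k -> Tor_inj (prod_cone F) P k.
Proof.
move=> inj t t0.
rewrite -(@Tor_map_id _ _ P _ (nt_comp lim_to_prod prod_to_lim) k _ t) //.
rewrite (@Tor_map_comp _ _ P _ _ _ lim_to_prod prod_to_lim) //.
rewrite [Tor_map P prod_to_lim k t]inj ?raddf0 // => j.
rewrite -(@Tor_map_comp _ _ P _ _ _ _ _ (leg_proj (prod_cone F) j)) //; exact: t0.
Qed.

Lemma Tor_surj_prod_lim k : Tor_surj (lim_cone N) P k -> Tor_surj (prod_cone F) P k.
Proof.
move=> surj c _; have [i j u|t tE] := surj c.
  exact: (@discrete_compatible _ (Tor_diagram P N k)).
exists (Tor_map P lim_to_prod k t) => -[i j]; rewrite -tE.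
by rewrite -(@Tor_map_comp _ _ P _ _ _ _ _ (limF_proj N (Tagged L j))).
Qed.
End DiscreteProduct.

(** * Resolutions by finitely generated covers *)

Section CoverResolution.
Variables (G : group) (X : subgroup_family G).
Local Notation C := (orbit_cat X).
Implicit Types (M B : module X).

(** Finite generation is conditional on [B], so the resolution can be fixed before it is known which
    syzygies are finitely generated. *)
Record cover B := Cover {
  cover_obj : module X;
  cover_map : nattrans cover_obj B;
  cover_projective : projective cover_obj;
  cover_surj : forall E, surjective (cover_map E);
  cover_fgen : fgen B -> fgen cover_obj }.

Lemma cover_exists B : inhabited (cover B).
Proof.
have [[m [D [b bs]]]|nfg] := pselect (fgen B); constructor.
  exists (free_sum D) (sum_lift b) => // [|_]; first exact: free_sum_projective.
  exact: free_sum_fgen.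
exists (freeF B) (freeF_cover B) => // [|E]; first exact: freeF_proj.
exact: freeF_cover_surj.
Qed.

Definition the_cover B : cover B := inhabited_witness (cover_exists B).

Variable A : module X.

Fixpoint cover_syzygy (k : nat) : module X :=
  if k is k'.+1 then kerF (cover_map (the_cover (cover_syzygy k'))) else A.

Definition cover_res k : module X := cover_obj (the_cover (cover_syzygy k)).

Definition cover_aug k : nattrans (cover_res k) (cover_syzygy k) :=
  cover_map (the_cover (cover_syzygy k)).

Definition cover_d k : nattrans (cover_res k.+1) (cover_res k) :=
  nt_comp (kerF_val (cover_aug k)) (cover_aug k.+1).

Lemma cover_d_exact k E : exact (cover_d k E) (cover_aug k E).
Proof.
move=> v; split=> [v0|[u <-]]; last exact: kerE (cover_aug k.+1 E u).
have [u uE] := @cover_surj _ (the_cover (cover_syzygy k.+1)) E (ker_elt v0).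
by exists u; rewrite -[LHS]/(val (cover_aug k.+1 E u)) [X in val X]uE val_ker_elt.
Qed.

(** The inclusion of a kernel is injective, so [cover_d k] and [cover_aug k.+1] have the same
    kernel. *)
Lemma cover_dd_exact k E : exact (cover_d k.+1 E) (cover_d k E).
Proof.
move=> v; rewrite -cover_d_exact; split=> [dv|v0]; first exact: val_inj.
exact: (congr1 (fun z : subgrp (kernel (cover_aug k E)) => val z) v0).
Qed.

Definition cover_resolution : resolution A :=
  @Resolution _ A cover_res (fun k => @cover_projective _ _) cover_d (cover_aug 0)
    (@cover_surj _ _) (@cover_d_exact 0) cover_dd_exact.
End CoverResolution.

(** * Lifting families to the product modulo boundaries *)

Section CokernelOfProducts.
Variables (C : category) (A : functor (opcat C)) (Q : resolution A).
Variables (J : Type) (c : cone (fun _ _ : J => False) C) (k : nat).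
Hypothesis tensor_iso : forall i, (i < k)%N -> tensor_inj c (Q i) /\ tensor_surj c (Q i).
Hypothesis inj : forall i, (i < k)%N -> Tor_inj c Q i.
Hypothesis surj : Tor_surj c Q k.

(* The cycle y representing the boundaries d(v_j) is itself a boundary, because
   Tor_(k-1) of the product embeds in the product of the Tor_(k-1). *)
Lemma boundary_lift (v : forall j, tensor (leg c j) (Q k)) :
  exists w, forall j, tor_d Q (leg c j) k (tor_chain Q (leg_proj c j) k w) =
                      tor_d Q (leg c j) k (v j).
Proof.
case: k tensor_iso inj v => [|k'] ti injk v; first by exists 0.
have [injT surjT] := ti k' (leqnn _).
have [i j []|y yE] := surjT (fun j => tor_d Q (leg c j) k'.+1 (v j)).
(* For [k' = 0] the predecessor is [0] itself, still within the range of the hypothesis. *)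
have [injT' _] := ti k'.-1 (leq_pred _).
have dy : tor_d Q (apex c) k' y = 0.
  apply: injT' => j; rewrite -[LHS](@tor_chainP _ _ Q _ _ (leg_proj c j) k' y).
  by rewrite [tor_chain _ _ _ _]yE tor_dd.
have /hclass_eq0 [w wE] : hclass (tor_d Q (apex c) k'.+1) dy = 0.
  apply: (injk k' (leqnn _)) => j; rewrite [LHS]homology_map_hclass.
  by apply/hclass_eq0; exists (v j); rewrite [RHS]yE.
exists w => j; rewrite -yE -wE.
exact: (@tor_chainP _ _ Q _ _ (leg_proj c j) k'.+1 w).
Qed.

(** Subtracting the components of [w] turns the [v j] into cycles, whose classes come from some
    cycle [t] by surjectivity on Tor; [t + w] is then the lift. *)
Lemma lift_modulo_boundaries (v : forall j, tensor (leg c j) (Q k)) :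
  exists t, forall j, exists e,
    v j = tor_chain Q (leg_proj c j) k t + tor_d Q (leg c j) k.+1 e.
Proof.
have [w wE] := boundary_lift v.
have zd j : tor_d Q (leg c j) k (v j - tor_chain Q (leg_proj c j) k w) = 0.
  by rewrite raddfB wE subrr.
have [i j []|h hE] := @surj (fun j => hclass (tor_d Q (leg c j) k.+1) (zd j)).
have [t [dt tE]] := hclassP h; exists (t + w) => j.
have := hE j; rewrite tE [X in X = _]homology_map_hclass => /esym/hclass_eq [e eE].
exists e; rewrite eE raddfD.
set a := tor_chain _ _ _ t; set b := tor_chain _ _ _ w.
by rewrite -[v j - b - a]addrA -opprD [b + a]addrC addrC [RHS]addrA subrr add0r.
Qed.
End CokernelOfProducts.

(** * Tensor products with a free comodule *)

Section Evaluation.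
Variables (G : group) (X : subgroup_family G).
Local Notation C := (orbit_cat X).
Variables (M B : module X) (e : nattrans M B) (D : orbit X).

Lemma evD (E : orbit X) (b b' : B E) (E' : orbit X) w :
  ev (b + b') E' w = ev b E' w + ev b' E' w.
Proof.
move: w; apply: (@freeg_ext _ _ (ev _ E') (ev b E' \+ ev b' E')) => u.
by rewrite [LHS]evU raddfD -!evU.
Qed.

Lemma ev_post (E E' E'' : orbit X) (f : gmap E E') (b : B E') w :
  ev b E'' (Zpost E'' f w) = ev (fmap B (f : @mor (opcat C) E' E) b) E'' w.
Proof.
move: w; apply: (@freeg_ext _ _ (ev b E'' \o Zpost E'' f) (ev _ E'')) => u.
rewrite [LHS](congr1 (ev b E'') (freeg_mapU _ _)) [LHS]evU [RHS]evU -fmap_comp.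
by congr (fmap B _ _); apply: gmap_ext.
Qed.

(** The Yoneda map from Z[D, -] (x) M to M(D), followed by [e]. *)
Definition tensor_ev : {additive tensor (free_comodule D) M -> B D}.
Proof.
refine (@tensor_lift C (free_comodule D) M (B D)
  (fun E (w : Zmaps D E) a => ev (e E a) D w) _ _ _).
- by move=> E w w' a; apply: raddfD.
- by move=> E w a a'; rewrite raddfD; apply: evD.
- by move=> E E' f w a; rewrite [LHS]ev_post naturality.
Defined.

Lemma tensor_ev_pure (E : orbit X) (w : free_comodule D E) (a : M E) :
  tensor_ev (pure w a) = ev (e E a) D w.
Proof. exact: tensor_lift_pure. Qed.
End Evaluation.

(** * The three implications *)

Section Main.
Variables (G : group) (X : subgroup_family G) (n : option nat) (A : module X).
Implicit Types P Q : resolution A.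

Lemma FP_commutes_exact_limits P : Bredon_FP n A -> Tor_commutes_exact_limits n P.
Proof.
move=> [Q Qfg] I N exI.
have tens i : (if n is Some m then (i <= m)%N else true) ->
    tensor_inj (lim_cone N) (Q i) /\ tensor_surj (lim_cone N) (Q i).
  move=> /Qfg/finitely_generated_fgen Qi; apply: fgen_projective_tensor Qi _ _.
    exact: res_proj.
  exact: lim_cone_limit.
suff [injT surjT] : (forall k, (if n is Some m then (k < m)%N else true) ->
      Tor_inj (lim_cone N) Q k) /\
    (forall k, (if n is Some m then (k <= m)%N else true) -> Tor_surj (lim_cone N) Q k).
  split=> [k kn|k kn].
    apply/bij_inj_surj; split.
      exact/Tor_lim_injP/(Tor_inj_compare (P := Q))/injT.
    apply/Tor_lim_surjP/(Tor_surj_compare (P := Q))/surjT.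
    by case: n kn => // m; apply: ltnW.
  by apply/Tor_lim_surjP/(Tor_surj_compare (P := Q))/surjT; rewrite kn.
(* Exactness of limits of comodules carries over to abelian groups by evaluation at an object. If
   there is none, every Tor group vanishes. *)
have [[x]|C0] := pselect (inhabited (orbit_cat X)); last first.
  have Tor0 L k (h : Tor Q L k) : h = 0.
    have [v [dv ->]] := hclassP h; apply/hclass_eq0; exists 0.
    by rewrite raddf0 (tensor_eq0 v C0).
  split=> k _; first by move=> t _; apply: Tor0.
  by move=> f _; exists 0 => j; rewrite [LHS]Tor0 [RHS]Tor0.
have lifts := exact_limits_lift x exI.
(* Injectivity uses finite generation in degrees [k] and [k.+1], surjectivity only in [k.-1] and
   [k]; hence only an epimorphism in the top degree. *)
split=> k kn.
  apply: Tor_lim_inj => //; apply tens; last by case: n kn.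
  by case: n kn => // m; apply: ltnW.
apply: Tor_lim_surj => //; apply tens => //.
by case: n kn => // m; apply/leq_trans/leq_pred.
Qed.

Lemma commutes_exact_limits_free_products P :
  Tor_commutes_exact_limits n P -> Tor_commutes_free_products n P.
Proof.
move=> limP L; set F := fun K (_ : L K) => free_comodule (coset_orbit K).
have [below at_n] := limP _ (discrete_diagram (fun p : {K & L K} => F _ (tagged p)))
  (@exact_limits_discrete {K & L K} (orbit_cat X)).
split=> k kn; last by apply/Tor_prod_surjP/Tor_surj_prod_lim/Tor_lim_surjP/at_n.
have [injT surjT] := proj1 (bij_inj_surj _) (below k kn).
apply/bij_inj_surj; split; first exact/Tor_prod_injP/Tor_inj_prod_lim/Tor_lim_injP.
exact/Tor_prod_surjP/Tor_surj_prod_lim/Tor_lim_surjP.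
Qed.

(* With the elements q of Q_k(G/K) as index set, lift the family of all id (x) q
   to a tensor t modulo boundaries.  As t is a finite sum of tensors l_j (x) q_j,
   every q is a combination of the q_j modulo boundaries. *)
Lemma commutes_free_products_fgen P k :
  Tor_commutes_free_products n P -> (if n is Some m then (k <= m)%N else true) ->
  (forall i, (i < k)%N -> fgen (cover_res A i)) -> fgen (cover_syzygy A k).
Proof.
move=> prodP kn fg; pose Q := cover_resolution A.
pose F (K : {K | X K}) (_ : Q k (coset_orbit K)) := free_comodule (coset_orbit K).
have [below at_n] := prodP (fun K => Q k (coset_orbit K)).
have injQ i : (i < k)%N -> Tor_inj (prod_cone F) Q i.
  move=> ik; apply: (Tor_inj_compare (P := P)); apply/Tor_prod_injP.
  have [|] := proj1 (bij_inj_surj _) (below i _) => //.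
  by case: n kn => // m; apply: leq_trans.
have surjQ : Tor_surj (prod_cone F) Q k.
  apply: (Tor_surj_compare (P := P)); apply/Tor_prod_surjP.
  (* Surjectivity in degree [k] is the epimorphism condition if [k] equals [n], and part of the
     isomorphism condition otherwise. *)
  have [kE|kE] := pselect (n = Some k); first exact: at_n.
  have [|] := proj1 (bij_inj_surj _) (below k _) => //.
  case: n kn kE => // m km kE; rewrite ltn_neqAle km andbT.
  by apply/eqP => kmE; apply: kE; rewrite kmE.
have tens i : (i < k)%N ->
    tensor_inj (prod_cone F) (Q i) /\ tensor_surj (prod_cone F) (Q i).
  move=> /fg Qi; apply: (fgen_projective_tensor (M := Q i)) Qi _ _.
    exact: res_proj.
  exact: prod_cone_limit.
pose v (p : {K & Q k (coset_orbit K)}) : tensor (leg (prod_cone F) p) (Q k) :=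
  pure (L := free_comodule (coset_orbit (tag p)))
    << (gmap_id (coset_orbit (tag p)) :
        {classic gmap (coset_orbit (tag p)) (coset_orbit (tag p))}) >> (tagged p).
have [t tE] := lift_modulo_boundaries tens injQ surjQ v.
have [m [D [l [q tq]]]] := tensor_finite_sum t.
exists m, D, (fun j => cover_aug A k (D j) (q j)).
apply: surj_on_cosets => K a.
have [a' a'E] := @cover_surj _ _ _ (the_cover (cover_syzygy A k)) (coset_orbit K) a.
pose p : {K & Q k (coset_orbit K)} := Tagged (fun K => Q k (coset_orbit K)) a'.
(* The coefficients are the entries of the [l j] at the index [(K, a')], formal sums of G-maps from
   G/K to [D j]. *)
exists (fun j => l j K a').
have [e eE] := tE p.
pose phi := tensor_ev (cover_aug A k) (coset_orbit K).
(* [phi] kills boundaries, so applying it to [eE] expresses [a] through the generators without error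
   term. *)
have phid u : phi (tensor_map (nt_id _) (cover_d A k) u) = 0.
  move: u; apply: (@tensor_ext _ _ _ _ (phi \o tensor_map (nt_id _) (cover_d A k)) \0).
  move=> E w x; rewrite -[LHS]/(phi (tensor_map (nt_id _) (cover_d A k) (pure w x))).
  rewrite tensor_map_pure [LHS]tensor_ev_pure.
  have -> : cover_aug A k E (cover_d A k E x) = 0 by apply/cover_d_exact; exists x.
  rewrite -[RHS]/((\0 : {additive _ -> _}) w).
  move: w; apply: (@freeg_ext _ _ (ev _ _) \0) => u.
  by rewrite [LHS]evU raddf0.
have := congr1 phi eE; rewrite raddfD phid addr0 [LHS]tensor_ev_pure [LHS]evU fmap_id.
rewrite a'E => ->; rewrite tq !raddf_sum sum_liftE; apply: eq_bigr => j _.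
by rewrite [X in _ = phi X]tensor_map_pure [RHS]tensor_ev_pure.
Qed.

(** Strong induction on the degree: finitely generated covers below [i] make the [i]-th syzygy
    finitely generated, and hence its cover. *)
Lemma commutes_free_products_FP P :
  Tor_commutes_free_products n P -> Bredon_FP n A.
Proof.
move=> prodP; exists (cover_resolution A) => i ile.
apply: fgen_finitely_generated; move: ile; have [k] := ubnP i.
elim: k i => // k IH i /ltnSE ik ile.
apply: cover_fgen; apply: (commutes_free_products_fgen prodP ile) => j ji.
apply: IH; first exact: leq_trans ji ik.
by case: n ile => // m; apply/leq_trans/ltnW.
Qed.
End Main.

(** Tor is computed from an arbitrary resolution [P], which need not be the one that witnesses
    [Bredon_FP]. *)
Theorem theorem5p4 (G : group) (X : subgroup_family G) (n : option nat)
    (A : module X) (P : resolution A) :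
  (Bredon_FP n A <-> Tor_commutes_exact_limits n P) /\
  (Bredon_FP n A <-> Tor_commutes_free_products n P).
Proof.
have i_ii := @FP_commutes_exact_limits G X n A P.
have ii_iii := @commutes_exact_limits_free_products G X n A P.
have iii_i := @commutes_free_products_FP G X n A P.
by split; split=> // H; [apply/iii_i/ii_iii | apply/ii_iii/i_ii].
Qed.
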